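(* Let $A$ be a finite dimensional weak $C^*$-Hopf algebra, let $l\in\mathcal L(A)$ and $\lambda\in\mathcal L(\hat A)$ be a dual pair of nondegenerate left integrals, and let $M$ be an $A$-module algebra with $N:=M^A$. Let $\hat E_\lambda:M\rtimes A\to M\equiv(M\rtimes1)$ be given by $\hat E_\lambda(m\rtimes a)=(m\rtimes(\lambda\rightharpoonup a))\equiv(m((\lambda\rightharpoonup a)\triangleright1_M)\rtimes1)$. Then $\hat E_\lambda$ is of index-finite type with quasi-basis $\sum_iu_i\otimes v_i=(1_M\rtimes l_{(2)})\otimes(1_M\rtimes S^{-1}(l_{(1)}))$, and $$\hat E_\lambda(1_M\rtimes l)=1_M,$$ $$\hat E_\lambda(1_M\rtimes1)=\tau_\triangleright(n_R(\lambda))\equiv\tau_\triangleright(\mathrm{Ind}\,l)\in C(M)\cap M_R,$$ $$\mathrm{Ind}\,\hat E_\lambda=(1_M\rtimes\mathrm{Ind}\,\lambda)\in(M\rtimes A)_R\cap C(M\rtimes A).$$ Moreover, if $l$ is normalized, $\mathrm{Ind}\,l$ is invertible and $\mathrm{Ind}\,l\in\hat A_L\cap\hat A_R\cap C(\hat A)$, then with $\dot\lambda:=n_R(\lambda)^{-1}\lambda$ we have $\hat E_\lambda=\tau_\triangleright(\mathrm{Ind}\,l)\,\hat E_{\dot\lambda}$ and $$\tau_\triangleright(\mathrm{Ind}\,l)\equiv(\tau_\triangleright(\mathrm{Ind}\,l)\rtimes1)=(1_M\rtimes\mathrm{Ind}\,\dot\lambda)\in N\cap C(M\rtimes A).$$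
   Context: A finite dimensional weak $C^*$-Hopf algebra is a finite dimensional $C^*$-algebra $A$ (unit $1$) with linear maps $\Delta:A\to A\otimes A$, $\varepsilon:A\to\mathbb C$, $S:A\to A$ such that, for all $x,y,z\in A$ in Sweedler notation: $\Delta(xy)=\Delta(x)\Delta(y)$; $\Delta(x^* )=\Delta(x)^*$; $(\Delta\otimes\mathrm{id})\Delta=(\mathrm{id}\otimes\Delta)\Delta$; $(\Delta(1)\otimes1)(1\otimes\Delta(1))=1_{(1)}\otimes1_{(2)}\otimes1_{(3)}$; $(\varepsilon\otimes\mathrm{id})\Delta=\mathrm{id}=(\mathrm{id}\otimes\varepsilon)\Delta$; $\varepsilon(xyz)=\varepsilon(xy_{(1)})\varepsilon(y_{(2)}z)$; $S(x_{(1)})x_{(2)}=1_{(1)}\varepsilon(x1_{(2)})$; $x_{(1)}S(x_{(2)})=\varepsilon(1_{(1)}x)1_{(2)}$; $S(x_{(1)})x_{(2)}S(x_{(3)})=S(x)$. ($\Delta(1)\neq 1\otimes 1$ in general; $S$ is automatically invertible.) Put $x_*:=S(x)^*$. The dual $\hat A$ is the dual vector space with $\langle\psi\varphi|x\rangle=\langle\psi\otimes\varphi|\Delta(x)\rangle$, $\langle\hat\Delta(\psi)|x\otimes y\rangle=\langle\psi|xy\rangle$, $\hat1=\varepsilon$, $\hat\varepsilon(\psi)=\langle\psi|1\rangle$, $\langle\hat S(\psi)|x\rangle=\langle\psi|S(x)\rangle$, $\langle\psi^*|x\rangle=\overline{\langle\psi|x_*\rangle}$; it is again a finite dimensional weak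 $C^*$-Hopf algebra, with dual $A$. Write $\langle a\rightharpoonup\varphi|b\rangle=\langle\varphi|ba\rangle$, $\langle\varphi\leftharpoonup a|b\rangle=\langle\varphi|ab\rangle$, $\varphi\rightharpoonup a=a_{(1)}\langle\varphi|a_{(2)}\rangle$. $A_L=\{(\varphi\otimes\mathrm{id})(\Delta(1)):\varphi\in\hat A\}$, $A_R=\{(\mathrm{id}\otimes\varphi)(\Delta(1)):\varphi\in\hat A\}$; similarly $\hat A_L=\hat1\leftharpoonup A$, $\hat A_R=A\rightharpoonup\hat1$. $C(\cdot)$ is the center. Integrals (equally for $\hat A$): $l\in\mathcal L(A)$ (left integral) iff $al=a_{(1)}S(a_{(2)})l$ for all $a\in A$. $l$ is nondegenerate if $(\varphi,\psi)\mapsto\langle l|\varphi\psi\rangle$ is nondegenerate on $\hat A$; normalized if $l\rightharpoonup\hat1=\hat1$. $l\in\mathcal L(A)$, $\lambda\in\mathcal L(\hat A)$ are dual if $\lambda\rightharpoonup l=1$ (equivalently $l\rightharpoonup\lambda=\hat1$; both are then nondegenerate). $n_R(l)=l_{(2)}S^{-1}(l_{(1)})$, $n_R(\lambda)=\lambda_{(2)}\hat S^{-1}(\lambda_{(1)})$. A map $E:B\to D\subset B$ is of index-finite type if there is a finite quasi-basis $u_i,v_i\in B$ with $\sum_iu_iE(v_ib)=b=\sum_iE(bu_i)v_i$ for all $b\in B$; its (Watatani) index is $\mathrm{Ind}\,E=\sum_iu_iv_i$. $\mathrm{Ind}\,l\in\hat A_R\cap C(\hat A)$ is the index of $\hat A\to\hat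 A_L$, $\varphi\mapsto l\rightharpoonup\varphi$; $\mathrm{Ind}\,\lambda\in A_R\cap C(A)$ is the index of $A\to A_L$, $a\mapsto\lambda\rightharpoonup a$. An $A$-module algebra is a unital $*$-algebra $M$ with a linear left action $\triangleright$ of $A$ with $(ab)\triangleright m=a\triangleright(b\triangleright m)$, $1\triangleright m=m$, $a\triangleright(mn)=(a_{(1)}\triangleright m)(a_{(2)}\triangleright n)$, $(a\triangleright m)^*=a_*\triangleright m^*$, $a\triangleright1_M=(a_{(1)}S(a_{(2)}))\triangleright1_M$. $M_R:=A\triangleright1_M$; $M^A=\{n: a\triangleright n=a_{(1)}S(a_{(2)})\triangleright n\ \forall a\}$; $\tau_\triangleright:\hat A_R\to M_R$ is the well defined map $a\rightharpoonup\hat1\mapsto a\triangleright1_M$. The crossed product $M\rtimes A=M\otimes_{A_L}A$ (elements $(m\rtimes a)$ modulo $(m\rtimes ba)=(m(b\triangleright1_M)\rtimes a)$, $b\in A_L$) has product $(m\rtimes a)(m'\rtimes a')=(m(a_{(1)}\triangleright m')\rtimes a_{(2)}a')$ and $(m\rtimes a)^*=(1_M\rtimes a^* )(m^*\rtimes1)$. It is an $\hat A$-module algebra via $\varphi\triangleright(m\rtimes a)=(m\rtimes(\varphi\rightharpoonup a))$, and $(M\rtimes A)_R:=\hat A\triangleright(1_M\rtimes1)=(1_M\rtimes A_R)$. *)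

(* Defs.v *)
From HB Require Import structures.
From mathcomp Require Import all_boot all_order all_algebra all_field.
From mathcomp Require Import boolp classical_sets.
From mathcomp Require Import ring.

Set Implicit Arguments.
Unset Strict Implicit.
Unset Printing Implicit Defensive.

Import Order.TTheory GRing.Theory Num.Theory.
Import VectorInternalTheory.

Local Open Scope ring_scope.
Local Open Scope classical_set_scope.

Reserved Notation "u ⊗ v" (at level 40, left associativity).
Reserved Notation "m ⋊ a" (at level 40, left associativity).
Reserved Notation "a ▷ m" (at level 38, right associativity).
Reserved Notation "⟨ psi | x ⟩" (at level 0, psi at level 50, x at level 50).
Reserved Notation "\sw_ ( x , y <- t ) E"
  (at level 36, E at level 36, x name, y name, t at level 50).

(* For V finite-dimensional with canonical basis (e_i), every element of U ⊗ V
   is sum_i t_i ⊗ e_i for a unique family (t_i) in U: U ⊗ V is encoded by these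
   families.  U may be infinite-dimensional. *)
Section Tensor.
Context {F : fieldType}.
Implicit Types (U W : lmodType F) (V : vectType F).

Definition vb V (i : 'I_(dim V)) : V := r2v (delta_mx 0 i).
Definition vcoord V (i : 'I_(dim V)) (v : V) : F := v2r v 0 i.

Lemma vcoordD V i (u v : V) : vcoord i (u + v) = vcoord i u + vcoord i v.
Proof. by rewrite /vcoord linearD mxE. Qed.

Lemma vcoordZ V i c (v : V) : vcoord i (c *: v) = c * vcoord i v.
Proof. by rewrite /vcoord linearZ mxE. Qed.

Lemma vcoord_vb V i j : vcoord j (vb i : V) = (j == i)%:R.
Proof. by rewrite /vcoord /vb r2vK mxE eqxx. Qed.

Lemma vb_sum V (v : V) : \sum_i vcoord i v *: vb i = v.
Proof.
apply: (can_inj v2rK); rewrite linear_sum [RHS]row_sum_delta.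
by apply: eq_bigr => i _; rewrite linearZ /= r2vK.
Qed.

Definition tensor U V := {ffun 'I_(dim V) -> U}.
HB.instance Definition _ U V := GRing.Lmodule.copy (tensor U V)
  {ffun 'I_(dim V) -> U}.
HB.instance Definition _ (U V : vectType F) := Vector.copy (tensor U V)
  {ffun 'I_(dim V) -> U}.

Definition tens U V (u : U) (v : V) : tensor U V :=
  [ffun i => vcoord i v *: u].

(* Sweedler-style evaluation: if t = sum_k x_k ⊗ y_k then
   \sw_(x, y <- t) f x y = sum_k f x_k y_k, for biadditive f that is balanced
   over F; see tsum_tens. *)
Definition tsum U V (W : zmodType) (t : tensor U V) (f : U -> V -> W) : W :=
  \sum_i f (t i) (vb i).

Record balanced U V (W : zmodType) (f : U -> V -> W) : Prop := Balanced {
  balDl : forall u u' v, f (u + u') v = f u v + f u' v;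
  balDr : forall u v v', f u (v + v') = f u v + f u v';
  balZ : forall c u v, f (c *: u) v = f u (c *: v) }.

End Tensor.

Notation "u ⊗ v" := (tens u v) : ring_scope.
Notation "\sw_ ( x , y <- t ) E" := (tsum t (fun x y => E)) : ring_scope.

Section TensorTheory.
Context {F : fieldType}.
Implicit Types (U : lmodType F) (V : vectType F) (W : zmodType).

Lemma tens_balanced U V : balanced (@tens F U V).
Proof.
split=> *; apply/ffunP => i; rewrite !ffunE ?scalerDr //.
  by rewrite vcoordD scalerDl.
by rewrite vcoordZ scalerA mulrC.
Qed.

Lemma tensZl U V c (u : U) (v : V) : (c *: u) ⊗ v = c *: (u ⊗ v).
Proof. by apply/ffunP => i; rewrite !ffunE !scalerA mulrC. Qed.

Lemma tensZr U V c (u : U) (v : V) : u ⊗ (c *: v) = c *: (u ⊗ v).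
Proof. by rewrite -(balZ (tens_balanced U V)) tensZl. Qed.

Lemma bal0l U V W (f : U -> V -> W) v :
  (forall u u' v, f (u + u') v = f u v + f u' v) -> f 0 v = 0.
Proof. by move=> fD; apply: (addIr (f 0 v)); rewrite -fD !add0r. Qed.

Lemma bal0r U V W (f : U -> V -> W) u :
  (forall u v v', f u (v + v') = f u v + f u v') -> f u 0 = 0.
Proof. by move=> fD; apply: (addIr (f u 0)); rewrite -fD !add0r. Qed.

Lemma tsumD U V W (f : U -> V -> W) (s t : tensor U V) :
  (forall u u' v, f (u + u') v = f u v + f u' v) ->
  tsum (s + t) f = tsum s f + tsum t f.
Proof. by move=> fD; rewrite -big_split; apply: eq_bigr => i _; rewrite ffunE fD. Qed.

Lemma tsum0 U V W (f : U -> V -> W) :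
  (forall u u' v, f (u + u') v = f u v + f u' v) -> tsum (0 : tensor U V) f = 0.
Proof. by move=> fD; rewrite /tsum big1 // => i _; rewrite ffunE bal0l. Qed.

Lemma tsum_sum U V W (f : U -> V -> W) I r (P : pred I) (T : I -> tensor U V) :
  (forall u u' v, f (u + u') v = f u v + f u' v) ->
  tsum (\sum_(i <- r | P i) T i) f = \sum_(i <- r | P i) tsum (T i) f.
Proof.
move=> fD; apply: (big_morph (fun t => tsum t f)); last exact: tsum0.
by move=> s t; apply: tsumD.
Qed.

Lemma tsum_tens U V W (f : U -> V -> W) (u : U) (v : V) :
  balanced f -> \sw_(x, y <- u ⊗ v) f x y = f u v.
Proof.
move=> fB; rewrite /tsum -[in RHS](vb_sum v).
rewrite (big_morph (f u) (balDr fB u) (bal0r _ (balDr fB))).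
by apply: eq_bigr => i _; rewrite ffunE balZ.
Qed.

Lemma tsumE U V (t : tensor U V) : \sw_(x, y <- t) (x ⊗ y) = t.
Proof.
apply/ffunP => j; rewrite sum_ffunE (bigD1 j) //= big1 ?addr0; last first.
  by move=> i ij; rewrite ffunE vcoord_vb eq_sym (negPf ij) scale0r.
by rewrite ffunE vcoord_vb eqxx scale1r.
Qed.

Lemma eq_tsum U V W (f g : U -> V -> W) (t : tensor U V) :
  (forall x y, f x y = g x y) -> tsum t f = tsum t g.
Proof. by move=> fg; apply: eq_bigr => i _; apply: fg. Qed.

(* every tensor also has a representation with second legs (e^j ⊗ id) t *)
Lemma tens_legs (U : vectType F) V (t : tensor U V) :
  t = \sum_j vb j ⊗ (\sw_(x, y <- t) (vcoord j x *: y)).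
Proof.
rewrite -[LHS]tsumE /tsum.
under [RHS]eq_bigr => j _.
  rewrite (big_morph (tens (vb j)) (balDr (tens_balanced _ _) _)
            (bal0r _ (balDr (tens_balanced _ _)))).
  under eq_bigr => i _ do rewrite -(balZ (tens_balanced _ _)).
  over.
rewrite exchange_big /=; apply: eq_bigr => i _.
rewrite -[in LHS](vb_sum (t i)).
apply: (big_morph (fun u => u ⊗ vb i)) => [x y|].
  exact: (balDl (tens_balanced _ _)).
exact: (bal0l _ (balDl (tens_balanced _ _))).
Qed.

Lemma tsum_tsum U V (U' : lmodType F) (V' : vectType F) W
    (t : tensor U V) (g : U -> V -> tensor U' V') (f : U' -> V' -> W) :
  (forall u u' v, f (u + u') v = f u v + f u' v) ->
  tsum (\sw_(x, y <- t) g x y) f = \sw_(x, y <- t) tsum (g x y) f.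
Proof. by move=> fD; rewrite /tsum -[LHS]/(tsum _ f) tsum_sum. Qed.

Lemma tsum_morph U V W W' (h : W -> W') (f : U -> V -> W) (t : tensor U V) :
  {morph h : x y / x + y} -> h 0 = 0 ->
  h (\sw_(x, y <- t) f x y) = \sw_(x, y <- t) h (f x y).
Proof. by move=> hD h0; apply: (big_morph h). Qed.

Lemma tens_suml U V I r (P : pred I) (u : I -> U) (v : V) :
  (\sum_(i <- r | P i) u i) ⊗ v = \sum_(i <- r | P i) (u i ⊗ v).
Proof.
apply: (big_morph (fun u => u ⊗ v)) => [x y|].
  exact: (balDl (tens_balanced _ _)).
exact: (bal0l _ (balDl (tens_balanced _ _))).
Qed.

Lemma tens_sumr U V I r (P : pred I) (u : U) (v : I -> V) :
  u ⊗ (\sum_(i <- r | P i) v i) = \sum_(i <- r | P i) (u ⊗ v i).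
Proof.
apply: (big_morph (fun v => u ⊗ v)) => [x y|].
  exact: (balDr (tens_balanced _ _)).
exact: (bal0r _ (balDr (tens_balanced _ _))).
Qed.

Lemma bal3 (A : vectType F) W (f : A -> A -> A -> W) :
  (forall z, balanced (fun x y => f x y z)) -> (forall x, balanced (f x)) ->
  balanced (fun (t : tensor A A) z => tsum t (fun x y => f x y z)).
Proof.
move=> f12 f23; have f13 c u v w : f (c *: u) v w = f u v (c *: w).
  by rewrite (balZ (f12 w)) (balZ (f23 u)).
split=> [s t z|t z z'|c t z].
- by rewrite tsumD // => *; exact: (balDl (f12 _)).
- by rewrite -big_split; apply: eq_bigr => i _; rewrite (balDr (f23 _)).
- by apply: eq_bigr => i _; rewrite ffunE f13.
Qed.

Lemma exchange_tsum U V (U' : lmodType F) (V' : vectType F) W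
    (s : tensor U V) (t : tensor U' V') (f : U -> V -> U' -> V' -> W) :
  \sw_(x, y <- s) \sw_(x', y' <- t) f x y x' y' =
  \sw_(x', y' <- t) \sw_(x, y <- s) f x y x' y'.
Proof. exact: exchange_big. Qed.

End TensorTheory.

Section Algebras.
Context {C : numClosedFieldType}.

Record star_algebra (B : algType C) := StarAlgebra {
  star :> B -> B;
  starD : forall x y, star (x + y) = star x + star y;
  starZ : forall (c : C) x, star (c *: x) = c^* *: star x;
  starM : forall x y, star (x * y) = star y * star x;
  starK : involutive star }.

(* The values of the norm are nonnegative in C, hence real; completeness is
   automatic in finite dimension. *)
Record is_cstar_norm (B : algType C) (s : star_algebra B) (nrm : B -> C) : Prop := {
  nrm_ge0 : forall x, 0 <= nrm x;
  nrm_eq0 : forall x, nrm x = 0 -> x = 0;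
  nrm_triangle : forall x y, nrm (x + y) <= nrm x + nrm y;
  nrmZ : forall (c : C) x, nrm (c *: x) = `|c| * nrm x;
  nrmM : forall x y, nrm (x * y) <= nrm x * nrm y;
  nrm_cstar : forall x, nrm (s x * x) = nrm x ^+ 2 }.

Definition is_cstar_algebra (B : falgType C) (s : star_algebra B) : Prop :=
  exists nrm, is_cstar_norm s nrm.

Definition center (B : nzRingType) : set B := [set x | forall y, x * y = y * x].

(* Quasi-bases and the Watatani index of a map E : B -> D with D included in B,
   viewed as a map B -> B; the sequence lists the pairs (u_i, v_i). *)
Definition quasi_basis (B : nzRingType) (E : B -> B) (s : seq (B * B)) : Prop :=
  forall b, \sum_(p <- s) p.1 * E (p.2 * b) = b /\
            \sum_(p <- s) E (b * p.1) * p.2 = b.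

Definition index_finite (B : nzRingType) (E : B -> B) : Prop :=
  exists s, quasi_basis E s.

(* The index does not depend on the quasi-basis (indexE); junk value 0 if E is
   not of index-finite type. *)
Definition Ind (B : nzRingType) (E : B -> B) : B :=
  xget 0 [set x | exists2 s, quasi_basis E s & x = \sum_(p <- s) p.1 * p.2].

Lemma indexE (B : nzRingType) (E : B -> B) s :
  quasi_basis E s -> Ind E = \sum_(p <- s) p.1 * p.2.
Proof.
move=> Es; rewrite /Ind; case: xgetP => [x -> [s' Es' ->]|/(_ (\sum_(p <- s) p.1 * p.2))].
  under eq_bigr => q _ do rewrite -(Es q.1).1 mulr_suml.
  rewrite exchange_big; apply: eq_bigr => p _.
  rewrite -[in RHS](Es' p.2).2 mulr_sumr.
  by apply: eq_bigr => q _; rewrite mulrA.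
by case; exists s.
Qed.

(* Comultiplication, counit and antipode, without axioms; shared by a weak
   Hopf algebra and its dual. *)
Record hopf_data (B : falgType C) := HopfData {
  cop : 'Hom(B, tensor B B);
  cou : 'Hom(B, C^o);
  anti : 'End(B) }.

Definition tmul (B : falgType C) (s t : tensor B B) : tensor B B :=
  \sw_(x, y <- s) \sw_(x', y' <- t) ((x * x') ⊗ (y * y')).

Definition tstar (B : falgType C) (st : star_algebra B) (t : tensor B B) :
    tensor B B :=
  \sw_(x, y <- t) (st x ⊗ st y).

Section HopfData.
Variables (B : falgType C) (D : hopf_data B).
Local Notation Δ := (cop D).
Local Notation ε := (cou D : B -> C).
Local Notation S := (anti D).

Record is_weak_hopf (st : star_algebra B) : Prop := {
  wh_copM : forall x y, Δ (x * y) = tmul (Δ x) (Δ y);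
  wh_cop_star : forall x, Δ (st x) = tstar st (Δ x);
  wh_coassoc : forall x,
    \sw_(a, b <- Δ x) (Δ a ⊗ b) =
    \sw_(a, b <- Δ x) \sw_(b1, b2 <- Δ b) ((a ⊗ b1) ⊗ b2);
  (* (Δ(1) ⊗ 1)(1 ⊗ Δ(1)), multiplied out, against 1_(1) ⊗ 1_(2) ⊗ 1_(3) *)
  wh_cop1 :
    \sw_(a, b <- Δ 1) \sw_(a', b' <- Δ 1) ((a ⊗ (b * a')) ⊗ b') =
    \sw_(a, b <- Δ 1) (Δ a ⊗ b);
  wh_counitl : forall x, \sw_(a, b <- Δ x) (ε a *: b) = x;
  wh_counitr : forall x, \sw_(a, b <- Δ x) (ε b *: a) = x;
  wh_couM : forall x y z,
    ε (x * y * z) = \sw_(y1, y2 <- Δ y) (ε (x * y1) * ε (y2 * z));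
  wh_antil : forall x,
    \sw_(a, b <- Δ x) (S a * b) = \sw_(a, b <- Δ 1) (ε (x * b) *: a);
  wh_antir : forall x,
    \sw_(a, b <- Δ x) (a * S b) = \sw_(a, b <- Δ 1) (ε (a * x) *: b);
  wh_anti3 : forall x,
    \sw_(a, b <- Δ x) \sw_(b1, b2 <- Δ b) (S a * b1 * S b2) = S x }.

(* a_(1) S(a_(2)) *)
Definition epsL (a : B) : B := \sw_(x, y <- Δ a) (x * S y).

Definition left_integral (l : B) : Prop := forall a, a * l = epsL a * l.

(* (S^-1)%VF is the inverse of S as soon as S is bijective *)
Definition nR (l : B) : B := \sw_(x, y <- Δ l) (y * (S^-1)%VF x).

Definition leftA : set B :=
  [set b | exists phi : 'Hom(B, C^o),
             b = \sw_(x, y <- Δ 1) ((phi x : C) *: y)].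

(* φ ⇀ a = a_(1) <φ|a_(2)> *)
Definition hit (phi : 'Hom(B, C^o)) (a : B) : B :=
  \sw_(x, y <- Δ a) ((phi y : C) *: x).

End HopfData.

Record weakCHopf (A : falgType C) := WeakCHopf {
  wh_data :> hopf_data A;
  wh_star : star_algebra A;
  wh_cstar : is_cstar_algebra wh_star;
  wh_axioms : is_weak_hopf wh_data wh_star }.

End Algebras.

Arguments center B : clear implicits.

Lemma linfunE (F : fieldType) (U V : vectType F) (f : U -> V) :
  linear f -> linfun f =1 f.
Proof.
move=> fL; pose g : {linear U -> V} := HB.pack f (GRing.isLinear.Build F U V _ f fL).
exact: (lfunE g).
Qed.

(* The argument H only serves to select the algebra structure below. *)
Definition dual {C : numClosedFieldType} {A : falgType C}
  (H : weakCHopf A) := 'Hom(A, C^o).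

Section Dual.
Context {C : numClosedFieldType} {A : falgType C}.
Variable H : weakCHopf A.
Local Notation Δ := (cop H).
Local Notation ε := (cou H).

Local Notation dH := (dual H).
HB.instance Definition _ := Vector.copy dH 'Hom(A, C^o).

Definition pairing (psi : dH) (x : A) : C := (psi : 'Hom(A, C^o)) x.
Local Notation "⟨ psi | x ⟩" := (pairing psi x).

Lemma dualP (psi phi : dH) : (forall x, ⟨ psi | x ⟩ = ⟨ phi | x ⟩) -> psi = phi.
Proof. by move=> e; apply/lfunP. Qed.

Definition dual_of (f : A -> C) : dH := linfun (f : A -> C^o).

Lemma dual_ofE f x : linear_for *%R f -> ⟨ dual_of f | x ⟩ = f x.
Proof. by move=> fL; rewrite /pairing /dual_of linfunE. Qed.

Lemma pairDr psi x y : ⟨ psi | x + y ⟩ = ⟨ psi | x ⟩ + ⟨ psi | y ⟩.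
Proof. exact: (linearD (psi : 'Hom(A, C^o))). Qed.
Lemma pairZr psi c x : ⟨ psi | c *: x ⟩ = c * ⟨ psi | x ⟩.
Proof. by rewrite /pairing linearZ. Qed.
Lemma pairDl psi phi x : ⟨ psi + phi | x ⟩ = ⟨ psi | x ⟩ + ⟨ phi | x ⟩.
Proof. by rewrite /pairing add_lfunE. Qed.
Lemma pairZl psi c x : ⟨ c *: psi | x ⟩ = c * ⟨ psi | x ⟩.
Proof. by rewrite /pairing scale_lfunE. Qed.
Lemma pair0r psi : ⟨ psi | 0 ⟩ = 0.
Proof. exact: (linear0 (psi : 'Hom(A, C^o))). Qed.
Lemma pair0l x : ⟨ 0 | x ⟩ = 0.
Proof. by rewrite /pairing lfunE. Qed.

Definition dual_mul (psi phi : dH) : dH :=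
  dual_of (fun x => \sw_(a, b <- Δ x) (⟨ psi | a ⟩ * ⟨ phi | b ⟩)).

Lemma dual_mul_bal psi phi :
  balanced (fun a b => ⟨ psi | a ⟩ * ⟨ phi | b ⟩).
Proof.
split=> *; first by rewrite pairDr mulrDl.
  by rewrite pairDr mulrDr.
by rewrite !pairZr mulrCA mulrA.
Qed.

Lemma dual_mulE psi phi x :
  ⟨ dual_mul psi phi | x ⟩ = \sw_(a, b <- Δ x) (⟨ psi | a ⟩ * ⟨ phi | b ⟩).
Proof.
rewrite dual_ofE // => c u v; rewrite linearP tsumD; last exact: balDl (dual_mul_bal _ _).
congr (_ + _); rewrite /tsum mulr_sumr; apply: eq_bigr => i _.
by rewrite ffunE pairZr mulrA.
Qed.

(* associativity of Sweedler sums, in functional form *)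
Lemma coassocE (W : zmodType) (f : A -> A -> A -> W) x :
  (forall z, balanced (fun x y => f x y z)) -> (forall x, balanced (f x)) ->
  \sw_(a, b <- Δ x) \sw_(a1, a2 <- Δ a) f a1 a2 b =
  \sw_(a, b <- Δ x) \sw_(b1, b2 <- Δ b) f a b1 b2.
Proof.
move=> f12 f23; have fB := bal3 f12 f23.
have := congr1 (fun t => tsum t (fun t z => tsum t (fun x y => f x y z)))
  (wh_coassoc (wh_axioms H) x).
rewrite tsum_tsum; last exact: balDl fB.
rewrite tsum_tsum; last exact: balDl fB.
under eq_tsum => a b do rewrite (tsum_tens _ _ fB).
move=> ->; apply: eq_tsum => a b.
rewrite tsum_tsum; last exact: balDl fB.
by apply: eq_tsum => b1 b2; rewrite (tsum_tens _ _ fB) tsum_tens.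
Qed.

Lemma dual_mulA : associative dual_mul.
Proof.
move=> p q r; apply: dualP => x; rewrite !dual_mulE.
under eq_tsum => a b do rewrite dual_mulE.
under [RHS]eq_tsum => a b do rewrite dual_mulE.
pose f a b c := ⟨ p | a ⟩ * ⟨ q | b ⟩ * ⟨ r | c ⟩.
transitivity (\sw_(a, b <- Δ x) \sw_(b1, b2 <- Δ b) f a b1 b2).
  apply: eq_tsum => a b; rewrite /tsum mulr_sumr; apply: eq_bigr => i _.
  by rewrite mulrA.
rewrite -coassocE.
- by apply: eq_tsum => a b; rewrite /tsum mulr_suml.
- by move=> z; split=> *; rewrite /f ?pairDr ?pairZr; ring.
- by move=> z; split=> *; rewrite /f ?pairDr ?pairZr; ring.
Qed.

Lemma pair_tsum (psi : dH) (U : lmodType C) (V : vectType C) (t : tensor U V)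
    (f : U -> V -> A) :
  ⟨ psi | \sw_(a, b <- t) f a b ⟩ = \sw_(a, b <- t) ⟨ psi | f a b ⟩.
Proof. by apply: tsum_morph; [exact: pairDr|exact: pair0r]. Qed.

Lemma dual_mul1l : left_id (ε : dH) dual_mul.
Proof.
move=> p; apply: dualP => x; rewrite dual_mulE.
rewrite -[in RHS](wh_counitl (wh_axioms H) x) pair_tsum.
by apply: eq_tsum => a b; rewrite pairZr.
Qed.

Lemma dual_mul1r : right_id (ε : dH) dual_mul.
Proof.
move=> p; apply: dualP => x; rewrite dual_mulE.
rewrite -[in RHS](wh_counitr (wh_axioms H) x) pair_tsum.
by apply: eq_tsum => a b; rewrite pairZr mulrC.
Qed.

Lemma dual_mulDl : left_distributive dual_mul +%R.
Proof.
move=> p q r; apply: dualP => x; rewrite pairDl !dual_mulE -big_split.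
by apply: eq_bigr => i _; rewrite pairDl mulrDl.
Qed.

Lemma dual_mulDr : right_distributive dual_mul +%R.
Proof.
move=> p q r; apply: dualP => x; rewrite pairDl !dual_mulE -big_split.
by apply: eq_bigr => i _; rewrite pairDl mulrDr.
Qed.

Lemma dual_one_neq0 : (ε : dH) != 0.
Proof.
apply/eqP => e0; have := oner_neq0 A.
rewrite -(wh_counitl (wh_axioms H) 1) /tsum big1 ?eqxx // => i _.
rewrite [X in X *: _](_ : _ = 0) ?scale0r //.
exact: (etrans (congr1 (fun p : dH => ⟨ p | _ ⟩) e0) (pair0l _)).
Qed.

HB.instance Definition _ := GRing.Zmodule_isNzRing.Build dH
  dual_mulA dual_mul1l dual_mul1r dual_mulDl dual_mulDr dual_one_neq0.

Lemma dual_scaleAl (c : C) (p q : dH) : c *: (p * q) = (c *: p) * q.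
Proof.
apply: dualP => x; rewrite pairZl !dual_mulE /tsum mulr_sumr.
by apply: eq_bigr => i _; rewrite pairZl mulrA.
Qed.

Lemma dual_scaleAr (c : C) (p q : dH) : c *: (p * q) = p * (c *: q).
Proof.
apply: dualP => x; rewrite pairZl !dual_mulE /tsum mulr_sumr.
by apply: eq_bigr => i _; rewrite pairZl mulrCA.
Qed.

HB.instance Definition _ := GRing.Lmodule_isLalgebra.Build C dH dual_scaleAl.
HB.instance Definition _ := GRing.Lalgebra_isAlgebra.Build C dH dual_scaleAr.
HB.instance Definition _ := Algebra_isFalgebra.Build C dH.

Lemma dual1E x : ⟨ 1 | x ⟩ = ε x. Proof. by []. Qed.
Lemma dualME p q x : ⟨ p * q | x ⟩ = \sw_(a, b <- Δ x) (⟨ p | a ⟩ * ⟨ q | b ⟩).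
Proof. exact: dual_mulE. Qed.

(* The element of dual ⊗ dual pairing with x ⊗ y to psi (x y), expanded in the
   basis dual to (vb i); see dual_copE. *)
Definition dual_cop (psi : dH) : tensor dH dH :=
  \sum_i \sum_j ⟨ psi | vb i * vb j ⟩ *:
    (dual_of (vcoord i) ⊗ dual_of (vcoord j)).

Lemma dual_cop_linear : linear dual_cop.
Proof.
move=> c u v; rewrite /dual_cop scaler_sumr -big_split; apply: eq_bigr => i _.
rewrite scaler_sumr -big_split; apply: eq_bigr => j _.
by rewrite pairDl pairZl scalerDl scalerA.
Qed.

Definition dual_data : hopf_data dH := {|
  cop := linfun dual_cop;
  cou := linfun ((fun psi => ⟨ psi | 1 ⟩) : dH -> C^o);
  anti := linfun ((fun psi => (psi \o anti H)%VF) : dH -> dH) |}.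

Lemma pair_vb psi x : ⟨ psi | x ⟩ = \sum_i vcoord i x * ⟨ psi | vb i ⟩.
Proof.
rewrite -[in LHS](vb_sum x) (big_morph _ (pairDr psi) (pair0r psi)).
by apply: eq_bigr => i _; rewrite pairZr.
Qed.

Lemma dual_copE psi x y :
  \sw_(p, q <- cop dual_data psi) (⟨ p | x ⟩ * ⟨ q | y ⟩) = ⟨ psi | x * y ⟩.
Proof.
have B : balanced (fun p q : dH => ⟨ p | x ⟩ * ⟨ q | y ⟩).
  by split=> *; rewrite ?pairDl ?pairZl; ring.
have vcl i : linear_for *%R (vcoord i : A -> C).
  by move=> c u v; rewrite vcoordD vcoordZ.
rewrite /= linfunE; last exact: dual_cop_linear.
rewrite tsum_sum; last exact: balDl B.
rewrite -[in RHS](vb_sum x) mulr_suml (big_morph _ (pairDr psi) (pair0r psi)).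
apply: eq_bigr => i _; rewrite tsum_sum; last exact: balDl B.
rewrite -[in RHS](vb_sum y) mulr_sumr (big_morph _ (pairDr psi) (pair0r psi)).
apply: eq_bigr => j _; rewrite -tensZl tsum_tens // pairZl !dual_ofE //.
by rewrite -scalerAl -scalerAr !pairZr; ring.
Qed.

Lemma dual_couE psi : cou dual_data psi = ⟨ psi | 1 ⟩.
Proof.
by rewrite /= linfunE // => c u v; rewrite pairDl pairZl.
Qed.

Lemma dual_antiE psi x : ⟨ anti dual_data psi | x ⟩ = ⟨ psi | anti H x ⟩.
Proof.
rewrite /= linfunE; first by rewrite /pairing comp_lfunE.
by move=> c u v; apply/lfunP => y; rewrite !(comp_lfunE, add_lfunE, scale_lfunE).
Qed.

Definition lact (a : A) (phi : dH) : dH := dual_of (fun b => ⟨ phi | b * a ⟩).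
Definition ract (phi : dH) (a : A) : dH := dual_of (fun b => ⟨ phi | a * b ⟩).

Lemma lactE a phi b : ⟨ lact a phi | b ⟩ = ⟨ phi | b * a ⟩.
Proof.
by rewrite dual_ofE // => c u v; rewrite mulrDl -scalerAl pairDr pairZr.
Qed.

Lemma ractE a phi b : ⟨ ract phi a | b ⟩ = ⟨ phi | a * b ⟩.
Proof.
by rewrite dual_ofE // => c u v; rewrite mulrDr -scalerAr pairDr pairZr.
Qed.

Definition dualL : set dH := [set psi | exists a, psi = ract 1 a].
Definition dualR : set dH := [set psi | exists a, psi = lact a 1].

(* nondegeneracy of (φ, ψ) |-> <l|φψ> on the dual, and of (a, b) |-> <λ|ab> *)
Definition nondegenerate_for (l : A) : Prop :=
  (forall phi : dH, (forall psi : dH, ⟨ phi * psi | l ⟩ = 0) -> phi = 0) /\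
  (forall psi : dH, (forall phi : dH, ⟨ phi * psi | l ⟩ = 0) -> psi = 0).

Definition nondegenerate_dual (lam : dH) : Prop :=
  (forall a, (forall b, ⟨ lam | a * b ⟩ = 0) -> a = 0) /\
  (forall b, (forall a, ⟨ lam | a * b ⟩ = 0) -> b = 0).

Definition normalized (l : A) : Prop := lact l 1 = 1.

Definition dual_integrals (l : A) (lam : dH) : Prop := hit H lam l = 1.

End Dual.

Arguments dualL {C A} H.
Arguments dualR {C A} H.
Arguments lact {C A} H.

Notation "⟨ psi | x ⟩" := (pairing psi x) : ring_scope.

Section HopfTheory.
Context {C : numClosedFieldType} {A : falgType C}.
Variable H : weakCHopf A.
Local Notation Δ := (cop H).
Local Notation ε := (cou H : A -> C).
Local Notation st := (wh_star H).

Lemma copD x y : Δ (x + y) = Δ x + Δ y. Proof. exact: linearD. Qed.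
Lemma copZ c x : Δ (c *: x) = c *: Δ x. Proof. exact: linearZ. Qed.
Lemma copME (W : zmodType) (f : A -> A -> W) x y : balanced f ->
  \sw_(a, b <- Δ (x * y)) f a b =
  \sw_(a, b <- Δ x) \sw_(a', b' <- Δ y) f (a * a') (b * b').
Proof.
move=> fB; rewrite (wh_copM (wh_axioms H)) /tmul tsum_tsum; last exact: balDl fB.
apply: eq_tsum => a b; rewrite tsum_tsum; last exact: balDl fB.
by apply: eq_tsum => a' b'; rewrite tsum_tens.
Qed.

Lemma bal_mul (W : zmodType) (f : A -> A -> W) (t : tensor A A) : balanced f ->
  balanced (fun x y => \sw_(x', y' <- t) f (x * x') (y * y')).
Proof.
move=> fB; split=> *.
- by rewrite -big_split; apply: eq_bigr => i _; rewrite mulrDl (balDl fB).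
- by rewrite -big_split; apply: eq_bigr => i _; rewrite mulrDl (balDr fB).
- by apply: eq_bigr => i _; rewrite -!scalerAl (balZ fB).
Qed.

Lemma cop_leftA_tens b : leftA H b -> Δ b = \sw_(x, y <- Δ 1) ((b * x) ⊗ y).
Proof.
case=> phi ->.
pose f (x y z : A) : tensor A A := (phi x : C) *: (y ⊗ z).
have f12 z : balanced (fun x y => f x y z).
  split=> *; rewrite /f ?linearD ?scalerDl //.
    by rewrite (balDl (tens_balanced A A)) scalerDr.
  by rewrite linearZ /= tensZl scalerA mulrC.
have f23 x : balanced (f x).
  split=> *; rewrite /f -?scalerDr.
  - by rewrite (balDl (tens_balanced A A)).
  - by rewrite (balDr (tens_balanced A A)).
  - by rewrite (balZ (tens_balanced A A)).
rewrite [LHS](tsum_morph _ _ copD (linear0 _)).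
transitivity (\sw_(a, b <- Δ 1) \sw_(b1, b2 <- Δ b) f a b1 b2).
  apply: eq_tsum => x y; rewrite copZ -[in LHS](tsumE (Δ y)) /tsum scaler_sumr.
  by [].
rewrite -coassocE //.
have fB := bal3 f12 f23.
have := congr1 (fun t => tsum t (fun t z => tsum t (fun x y => f x y z)))
  (wh_cop1 (wh_axioms H)).
rewrite tsum_tsum; last exact: balDl fB.
rewrite tsum_tsum; last exact: balDl fB.
under [X in _ = X -> _]eq_tsum => x y do rewrite (tsum_tens _ _ fB).
move=> <-; under eq_tsum => x y.
  rewrite tsum_tsum; last exact: balDl fB.
  under eq_tsum => x' y' do rewrite (tsum_tens _ _ fB) tsum_tens //.
  over.
rewrite exchange_tsum; apply: eq_tsum => x y;
rewrite [X in X ⊗ _]mulr_suml tens_suml.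
by apply: eq_bigr => i _; rewrite -scalerAl tensZl.
Qed.

Lemma cop_leftAE (W : zmodType) (f : A -> A -> W) b : leftA H b -> balanced f ->
  \sw_(x, y <- Δ b) f x y = \sw_(x, y <- Δ 1) f (b * x) y.
Proof.
move=> bL fB; rewrite cop_leftA_tens // tsum_tsum; last exact: balDl fB.
by apply: eq_tsum => x y; rewrite tsum_tens.
Qed.

Lemma star1 (B : algType C) (s : star_algebra B) : s 1 = 1.
Proof. by rewrite -[LHS]mulr1 -[X in _ * X](starK s) -starM mulr1 starK. Qed.

Lemma star0 (B : algType C) (s : star_algebra B) : s 0 = 0.
Proof. by apply: (addIr (s 0)); rewrite -starD !add0r. Qed.

Lemma cop_starE (W : zmodType) (f : A -> A -> W) x : balanced f ->
  \sw_(a, b <- Δ (st x)) f a b = \sw_(a, b <- Δ x) f (st a) (st b).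
Proof.
move=> fB; rewrite (wh_cop_star (wh_axioms H)) tsum_tsum; last exact: balDl fB.
by apply: eq_tsum => a b; rewrite tsum_tens.
Qed.

Lemma leftA_star b : leftA H b -> leftA H (st b).
Proof.
case=> phi ->.
pose f (x : A) : C := (phi (st x) : C)^*.
have fL : linear_for *%R f.
  by move=> c u v; rewrite /f starD starZ linearP rmorphD rmorphM /= conjCK.
exists (dual_of H f).
have -> := tsum_morph (fun x y => phi x *: y) (Δ 1) (starD st) (star0 st).
rewrite -[in RHS](star1 st) cop_starE; last first.
  split=> [u u' v|u v v'|c u v].
  - by rewrite -scalerDl; congr (_ *: _); apply: (@pairDr _ _ H).
  - by rewrite scalerDr.
  - rewrite scalerA mulrC; congr (_ *: _); apply: (@pairZr _ _ H).
apply: eq_tsum => x y; rewrite starZ; congr (_ *: _).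
by rewrite [RHS](dual_ofE H) // /f starK.
Qed.

Lemma cop_leftArE (W : zmodType) (f : A -> A -> W) b : leftA H b -> balanced f ->
  \sw_(x, y <- Δ b) f x y = \sw_(x, y <- Δ 1) f (x * b) y.
Proof.
move=> bL fB.
have fbB : balanced (fun x y => f (x * b) y).
  by split=> *; rewrite ?mulrDl -?scalerAl ?(balDl fB) ?(balDr fB) ?(balZ fB).
rewrite -{1}(starK st b) cop_starE // (cop_leftAE (leftA_star bL)); last first.
  split=> *; rewrite ?starD ?starZ ?(balDl fB) ?(balDr fB) //.
  by rewrite (balZ fB).
rewrite -[in RHS](star1 st) cop_starE //.
by apply: eq_tsum => x y; rewrite starM starK.
Qed.

Lemma cop_leftMlE (W : zmodType) (f : A -> A -> W) b a :
  leftA H b -> balanced f ->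
  \sw_(x, y <- Δ (b * a)) f x y = \sw_(x, y <- Δ a) f (b * x) y.
Proof.
move=> bL fB; rewrite copME // cop_leftAE //; last exact: bal_mul.
have fbB : balanced (fun x y => f (b * x) y).
  by split=> *; rewrite ?mulrDr -?scalerAr ?(balDl fB) ?(balDr fB) ?(balZ fB).
rewrite -[in RHS](mul1r a) copME //.
by apply: eq_tsum => x y; apply: eq_tsum => x' y'; rewrite mulrA.
Qed.

Lemma cop_leftMrE (W : zmodType) (f : A -> A -> W) b a :
  leftA H b -> balanced f ->
  \sw_(x, y <- Δ (a * b)) f x y = \sw_(x, y <- Δ a) f (x * b) y.
Proof.
move=> bL fB; rewrite copME //.
have fbB : balanced (fun x y => f (x * b) y).
  by split=> *; rewrite ?mulrDl -?scalerAl ?(balDl fB) ?(balDr fB) ?(balZ fB).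
rewrite -[in RHS](mulr1 a) copME // exchange_tsum.
under [RHS]eq_tsum => x y do under eq_tsum => x' y' do rewrite -mulrA.
rewrite [RHS]exchange_tsum cop_leftArE //.
split=> *.
- by rewrite -big_split; apply: eq_bigr => i _; rewrite mulrDr (balDl fB).
- by rewrite -big_split; apply: eq_bigr => i _; rewrite mulrDr (balDr fB).
- by apply: eq_bigr => i _; rewrite -!scalerAr (balZ fB).
Qed.

Lemma epsLE a : epsL H a = \sw_(x, y <- Δ 1) (ε (x * a) *: y).
Proof. exact: (wh_antir (wh_axioms H)). Qed.

Lemma epsL_leftA a : leftA H (epsL H a).
Proof.
exists (lact H a (cou H : dual H)); rewrite epsLE; apply: eq_tsum => x y.
by congr (_ *: _); rewrite -[RHS]/(⟨ lact H a (cou H : dual H) | x ⟩) lactE.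
Qed.

Lemma cou_bal : balanced (fun x y : A => ε x *: y).
Proof.
split=> [u u' v|u v v'|c u v].
- by rewrite -scalerDl; congr (_ *: _); apply: (@pairDr _ _ H).
- by rewrite scalerDr.
- by rewrite scalerA mulrC; congr (_ *: _); apply: (@pairZr _ _ H).
Qed.

Lemma epsL_id a : \sw_(x, y <- Δ a) (epsL H x * y) = a.
Proof.
rewrite -[RHS](wh_counitl (wh_axioms H)) -[in RHS](mul1r a) copME; last exact: cou_bal.
rewrite exchange_tsum; apply: eq_tsum => x y.
rewrite epsLE /tsum mulr_suml; apply: eq_bigr => i _.
by rewrite -scalerAl.
Qed.

End HopfTheory.

Section ModuleAlgebra.
Context {C : numClosedFieldType} {A : falgType C}.
Variable H : weakCHopf A.
Local Notation Δ := (cop H).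
Local Notation ε := (cou H : A -> C).
Local Notation S := (anti H).

Record module_algebra (M : algType C) := ModuleAlgebra {
  ma_star : star_algebra M;
  act : A -> M -> M;
  actDl : forall a b m, act (a + b) m = act a m + act b m;
  actZl : forall c a m, act (c *: a) m = c *: act a m;
  actDr : forall a m n, act a (m + n) = act a m + act a n;
  actZr : forall c a m, act a (c *: m) = c *: act a m;
  actA : forall a b m, act (a * b) m = act a (act b m);
  act1 : forall m, act 1 m = m;
  actM : forall a m n, act a (m * n) = \sw_(x, y <- Δ a) (act x m * act y n);
  act_star : forall a m,
    ma_star (act a m) = act (wh_star H (S a)) (ma_star m);
  act_one : forall a, act a 1 = act (epsL H a) 1 }.

Variables (M : algType C) (K : module_algebra M).
Local Notation "a ▷ m" := (act K a m).

Definition moduleR : set M := [set m | exists a, m = a ▷ 1].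

Definition invariants : set M := [set n | forall a, a ▷ n = epsL H a ▷ n].

(* The preimage a of phi under a |-> a ⇀ 1 is irrelevant (tauE); junk value off
   dualR. *)
Definition tau (phi : dual H) : M :=
  xget 0 [set a | phi = lact H a 1] ▷ 1.

Lemma act0l m : 0 ▷ m = 0.
Proof. by apply: (addIr (0 ▷ m)); rewrite -actDl !add0r. Qed.
Lemma act0r a : a ▷ 0 = 0.
Proof. by apply: (addIr (a ▷ 0)); rewrite -actDr !add0r. Qed.

Lemma tauE a : tau (lact H a 1) = a ▷ 1.
Proof.
rewrite /tau; case: xgetP => [b _ eab|/(_ a)]; last by case.
rewrite act_one [RHS]act_one; congr (act K _ _); rewrite !epsLE.
apply: eq_tsum => x y; congr (_ *: _).
by have := congr1 (fun p => ⟨ p | x ⟩) eab; rewrite !lactE !dual1E.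
Qed.

(* Generators of the relations (m ⊗ b a) ~ (m (b ▷ 1) ⊗ a), b in A_L. *)
Definition cross_gen : set (tensor M A) :=
  [set t | exists m b a, leftA H b /\ t = m ⊗ (b * a) - (m * (b ▷ 1)) ⊗ a].

Definition cross_rel_def : {pred tensor M A} := fun t =>
  `[< exists2 s : seq (tensor M A),
        (forall x, x \in s -> cross_gen x) & t = \sum_(x <- s) x >].

Lemma tensBl (m n : M) (a : A) : (m - n) ⊗ a = m ⊗ a - n ⊗ a.
Proof.
by rewrite (balDl (tens_balanced M A)) -scaleN1r tensZl scaleN1r.
Qed.

Lemma cross_genZ c t : cross_gen t -> cross_gen (c *: t).
Proof.
case=> m [b [a [bL ->]]]; exists (c *: m), b, a; split=> //.
by rewrite scalerBr -!tensZl -scalerAl.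
Qed.

Lemma cross_relZ c t : t \in cross_rel_def -> c *: t \in cross_rel_def.
Proof.
move=> /asboolP[s sg ->]; apply/asboolP; exists [seq c *: x | x <- s].
  by move=> _ /mapP[x xs ->]; apply/cross_genZ/sg.
by rewrite scaler_sumr big_map.
Qed.

Lemma cross_rel_zmod : zmod_closed cross_rel_def.
Proof.
have relD s t : s \in cross_rel_def -> t \in cross_rel_def ->
    s + t \in cross_rel_def.
  move=> /asboolP[r rg ->] /asboolP[q qg ->]; apply/asboolP.
  exists (r ++ q); last by rewrite big_cat.
  by move=> x; rewrite mem_cat => /orP[/rg|/qg].
split; first by apply/asboolP; exists [::] => //; rewrite big_nil.
by move=> s t sr /(cross_relZ (-1)); rewrite scaleN1r; apply: relD.
Qed.

Definition cross_rel := cross_rel_def.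
HB.instance Definition _ := GRing.isZmodClosed.Build (tensor M A) cross_rel
  cross_rel_zmod.

(* M ⊗ A over A_L *)
Definition crossed := Quotient.quot cross_rel.
HB.instance Definition _ := GRing.Zmodule.on crossed.

Definition cpi (t : tensor M A) : crossed := \pi_(Quotient.quot cross_rel)%qT t.


Lemma cpi_eq s t : s - t \in cross_rel -> cpi s = cpi t.
Proof. by move=> st; apply/eqP; rewrite /cpi -Quotient.idealrBE. Qed.

Lemma cpi_rel s t : cpi s = cpi t -> s - t \in cross_rel.
Proof. by move=> /eqP; rewrite /cpi -Quotient.idealrBE. Qed.

Lemma cpi_repr (x : crossed) : cpi (repr x) = x.
Proof. exact: reprK. Qed.

Lemma cpiD s t : cpi (s + t) = cpi s + cpi t.
Proof. exact: raddfD. Qed.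

Lemma cpi0 : cpi 0 = 0.
Proof. exact: raddf0. Qed.

Lemma cross_genP t : cross_gen t -> t \in cross_rel.
Proof.
move=> tg; apply/asboolP; exists [:: t]; last by rewrite big_seq1.
by move=> x; rewrite inE => /eqP ->.
Qed.

Lemma cross_rel_ind (P : tensor M A -> Prop) : P 0 ->
  (forall s t, P s -> P t -> P (s + t)) -> (forall t, cross_gen t -> P t) ->
  forall t, t \in cross_rel -> P t.
Proof.
move=> P0 PD Pg t /asboolP[s sg ->]; rewrite big_seq.
by apply: big_ind => // x xs; apply/Pg/sg.
Qed.

(* additive maps out of M ⊗ A that kill the relations factor through crossed *)
Lemma cross_factor (W : zmodType) (h : tensor M A -> W) :
  {morph h : x y / x + y} ->
  (forall m b a, leftA H b -> h (m ⊗ (b * a)) = h ((m * (b ▷ 1)) ⊗ a)) ->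
  forall s t, cpi s = cpi t -> h s = h t.
Proof.
move=> hD hg s t /cpi_rel st.
have h0 : h 0 = 0 by apply: (addIr (h 0)); rewrite -hD !add0r.
have hB x y : h (x - y) = h x - h y.
  by apply: (addIr (h y)); rewrite -hD !subrK.
apply/eqP; rewrite -subr_eq0 -hB; apply/eqP; move: (s - t) st.
apply: cross_rel_ind => // [x y hx hy|x [m [b [a [bL ->]]]]].
  by rewrite hD hx hy addr0.
by rewrite hB hg ?subrr.
Qed.

Definition cp (m : M) (a : A) : crossed := cpi (m ⊗ a).
Local Notation "m ⋊ a" := (cp m a).

Lemma cp_bal : balanced cp.
Proof.
split=> *; rewrite /cp -?cpiD ?(balDl (tens_balanced _ _)) //.
  by rewrite (balDr (tens_balanced _ _)).
by rewrite (balZ (tens_balanced _ _)).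
Qed.

Lemma cp_leftA m b a : leftA H b -> m ⋊ (b * a) = (m * (b ▷ 1)) ⋊ a.
Proof. by move=> bL; apply/cpi_eq/cross_genP; exists m, b, a. Qed.

Lemma cpi_sum I r (P : pred I) (F : I -> tensor M A) :
  cpi (\sum_(i <- r | P i) F i) = \sum_(i <- r | P i) cpi (F i).
Proof. exact: (big_morph _ cpiD cpi0). Qed.

Lemma cpi_tsum t : cpi t = \sw_(m, a <- t) (m ⋊ a).
Proof. by rewrite -[in LHS](tsumE t) cpi_sum. Qed.

Lemma cross_ind (P : crossed -> Prop) :
  (forall m a, P (m ⋊ a)) -> (forall x y, P x -> P y -> P (x + y)) ->
  forall x, P x.
Proof.
move=> Pg PD x; rewrite -(cpi_repr x) cpi_tsum; apply: big_ind => //.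
have -> : 0 = 0 ⋊ 0 by rewrite (bal0l _ (balDl cp_bal)).
exact: Pg.
Qed.

Definition cross_scale (c : C) (x : crossed) : crossed := cpi (c *: repr x).

Lemma cross_scaleE c t : cross_scale c (cpi t) = cpi (c *: t).
Proof.
by apply: cpi_eq; rewrite -scalerBr; apply/cross_relZ/cpi_rel/cpi_repr.
Qed.

Lemma cross_scaleA a b x : cross_scale a (cross_scale b x) = cross_scale (a * b) x.
Proof. by rewrite -(cpi_repr x) !cross_scaleE scalerA. Qed.
Lemma cross_scale1 : left_id 1 cross_scale.
Proof. by move=> x; rewrite -(cpi_repr x) !cross_scaleE scale1r. Qed.
Lemma cross_scaleDr : right_distributive cross_scale +%R.
Proof.
by move=> c x y; rewrite -(cpi_repr x) -(cpi_repr y) -cpiD !cross_scaleE -cpiD scalerDr.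
Qed.
Lemma cross_scaleDl x : {morph cross_scale^~ x : a b / a + b}.
Proof. by move=> a b; rewrite -(cpi_repr x) !cross_scaleE -cpiD scalerDl. Qed.

HB.instance Definition _ := GRing.Zmodule_isLmodule.Build C crossed
  cross_scaleA cross_scale1 cross_scaleDr cross_scaleDl.

Lemma cpZl c m a : (c *: m) ⋊ a = c *: (m ⋊ a).
Proof. by rewrite /cp tensZl -cross_scaleE. Qed.

(* (m ⋊ a)(m' ⋊ a') = m (a_(1) ▷ m') ⋊ a_(2) a', see cpM *)
Definition pre_mul (s t : tensor M A) : crossed :=
  \sw_(m, a <- s) \sw_(m', a' <- t) \sw_(x, y <- Δ a)
    ((m * (x ▷ m')) ⋊ (y * a')).

Lemma mul_bal4 m m' a' :
  balanced (fun x y => (m * (x ▷ m')) ⋊ (y * a')).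
Proof.
split=> *; rewrite ?actDl ?mulrDr ?mulrDl ?(balDl cp_bal) ?(balDr cp_bal) //.
by rewrite actZl -scalerAr -scalerAl (balZ cp_bal).
Qed.

Lemma mul_bal3 m a :
  balanced (fun m' a' => \sw_(x, y <- Δ a) ((m * (x ▷ m')) ⋊ (y * a'))).
Proof.
split=> *; rewrite -?big_split; apply: eq_bigr => i _.
- by rewrite actDr mulrDr (balDl cp_bal).
- by rewrite mulrDr (balDr cp_bal).
- by rewrite actZr -!scalerAr (balZ cp_bal).
Qed.

Lemma mul_bal2 t :
  balanced (fun m a => \sw_(m', a' <- t) \sw_(x, y <- Δ a)
    ((m * (x ▷ m')) ⋊ (y * a'))).
Proof.
split=> *; rewrite -?big_split; apply: eq_bigr => i _.
- by rewrite -big_split; apply: eq_bigr => j _; rewrite mulrDl (balDl cp_bal).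
- by rewrite copD tsumD //; exact: balDl (mul_bal4 _ _ _).
- rewrite copZ; apply: eq_bigr => j _; rewrite ffunE actZl.
  by rewrite -scalerAl -scalerAr.
Qed.

Lemma pre_mulDl s s' t : pre_mul (s + s') t = pre_mul s t + pre_mul s' t.
Proof. by apply: tsumD; exact: balDl (mul_bal2 t). Qed.

Lemma pre_mulDr s t t' : pre_mul s (t + t') = pre_mul s t + pre_mul s t'.
Proof.
rewrite -big_split; apply: eq_bigr => i _.
by apply: tsumD; exact: balDl (mul_bal3 _ _).
Qed.

Lemma pre_mul0l t : pre_mul 0 t = 0.
Proof. by apply: (addIr (pre_mul 0 t)); rewrite -pre_mulDl !add0r. Qed.
Lemma pre_mul0r s : pre_mul s 0 = 0.
Proof. by apply: (addIr (pre_mul s 0)); rewrite -pre_mulDr !add0r. Qed.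

Lemma pre_mul_suml I r (P : pred I) F t :
  pre_mul (\sum_(i <- r | P i) F i) t = \sum_(i <- r | P i) pre_mul (F i) t.
Proof.
by apply: (big_morph (pre_mul^~ t)) => [x y|]; [exact: pre_mulDl|exact: pre_mul0l].
Qed.
Lemma pre_mul_sumr I r (P : pred I) F s :
  pre_mul s (\sum_(i <- r | P i) F i) = \sum_(i <- r | P i) pre_mul s (F i).
Proof.
by apply: (big_morph (pre_mul s)) => [x y|]; [exact: pre_mulDr|exact: pre_mul0r].
Qed.

Lemma pre_mul_tens m a m' a' :
  pre_mul (m ⊗ a) (m' ⊗ a') = \sw_(x, y <- Δ a) ((m * (x ▷ m')) ⋊ (y * a')).
Proof. by rewrite /pre_mul (tsum_tens _ _ (mul_bal2 _)) (tsum_tens _ _ (mul_bal3 _ _)). Qed.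

Lemma act_leftA b m : leftA H b -> b ▷ m = (b ▷ 1) * m.
Proof.
have B (n k : M) : balanced (fun x y => (x ▷ n) * (y ▷ k)).
  split=> *; rewrite ?actDl ?mulrDl ?mulrDr //.
  by rewrite !actZl -scalerAl -scalerAr.
move=> bL; rewrite -[in LHS](mul1r m) actM (cop_leftArE bL) //.
by under eq_tsum => x y do rewrite actA; rewrite -actM act1.
Qed.

Lemma cp_epsL m a a' : \sw_(x, y <- Δ a) ((m * (x ▷ 1)) ⋊ (y * a')) = m ⋊ (a * a').
Proof.
under eq_tsum => x y do rewrite act_one -(cp_leftA _ _ (epsL_leftA _ _)) mulrA.
rewrite -[in RHS](epsL_id H a) [in RHS]/tsum mulr_suml.
by rewrite (big_morph _ (balDr cp_bal m) (bal0r m (balDr cp_bal))).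
Qed.

Lemma pre_mul_congl s s' t : cpi s = cpi s' -> pre_mul s t = pre_mul s' t.
Proof.
apply: (@cross_factor _ (pre_mul^~ t)) => [x y|m b a bL]; first exact: pre_mulDl.
rewrite -[t]tsumE /tsum.
rewrite !pre_mul_sumr; apply: eq_bigr => i _.
rewrite !pre_mul_tens (cop_leftMlE _ bL (mul_bal4 _ _ _)).
by apply: eq_tsum => x y; rewrite actA (act_leftA _ bL) mulrA.
Qed.

Lemma pre_mul_congr s t t' : cpi t = cpi t' -> pre_mul s t = pre_mul s t'.
Proof.
apply: (@cross_factor _ (pre_mul s)) => [x y|m' b a' bL]; first exact: pre_mulDr.
rewrite -[s]tsumE /tsum.
rewrite !pre_mul_suml.
apply: eq_bigr => i _; rewrite !pre_mul_tens.
move: (s i) (vb i) => m a.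
under [RHS]eq_tsum => x y do rewrite actM mulr_sumr.
pose f x1 x2 y := (m * ((x1 ▷ m') * (x2 ▷ (b ▷ 1)))) ⋊ (y * a').
transitivity (\sw_(x, y <- Δ a) \sw_(x1, x2 <- Δ x) f x1 x2 y); last first.
  apply: eq_tsum => x y.
  by rewrite (big_morph (cp^~ (y * a')) (fun u v => balDl cp_bal u v _)
    (bal0l _ (balDl cp_bal))).
rewrite coassocE; first last.
- move=> x; split=> *; rewrite /f ?actDl ?mulrDl ?mulrDr ?(balDl cp_bal) ?(balDr cp_bal) //.
  by rewrite actZl -!scalerAr -scalerAl (balZ cp_bal).
- move=> z; split=> *; rewrite /f ?actDl ?mulrDl ?mulrDr ?(balDl cp_bal) //.
  by rewrite !actZl -scalerAl -!scalerAr.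
apply: eq_tsum => x y; rewrite /f.
under [RHS]eq_tsum => y1 y2 do rewrite mulrA -actA.
pose g y1 y2 := ((m * (x ▷ m')) * (y1 ▷ 1)) ⋊ (y2 * a').
have gB : balanced g by exact: mul_bal4.
rewrite -[RHS](@cop_leftMrE _ _ _ _ g b y bL gB) /g.
by rewrite cp_epsL mulrA.
Qed.

Definition cross_mul (x y : crossed) : crossed := pre_mul (repr x) (repr y).

Lemma cross_mul_cpi s t : cross_mul (cpi s) (cpi t) = pre_mul s t.
Proof.
rewrite /cross_mul (@pre_mul_congl _ s) ?cpi_repr //.
by apply: pre_mul_congr; rewrite cpi_repr.
Qed.

Lemma cross_mul_cp m a m' a' :
  cross_mul (m ⋊ a) (m' ⋊ a') = \sw_(x, y <- Δ a) ((m * (x ▷ m')) ⋊ (y * a')).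
Proof. by rewrite cross_mul_cpi pre_mul_tens. Qed.

Lemma cross_mulDl : left_distributive cross_mul +%R.
Proof.
move=> x y z; rewrite -(cpi_repr x) -(cpi_repr y) -(cpi_repr z) -cpiD.
by rewrite !cross_mul_cpi pre_mulDl.
Qed.

Lemma cross_mulDr : right_distributive cross_mul +%R.
Proof.
move=> x y z; rewrite -(cpi_repr x) -(cpi_repr y) -(cpi_repr z) -cpiD.
by rewrite !cross_mul_cpi pre_mulDr.
Qed.

Lemma cross_mul0l x : cross_mul 0 x = 0.
Proof. by apply: (addIr (cross_mul 0 x)); rewrite -cross_mulDl !add0r. Qed.
Lemma cross_mul0r x : cross_mul x 0 = 0.
Proof. by apply: (addIr (cross_mul x 0)); rewrite -cross_mulDr !add0r. Qed.

Lemma cross_mul_suml I r (P : pred I) F x :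
  cross_mul (\sum_(i <- r | P i) F i) x = \sum_(i <- r | P i) cross_mul (F i) x.
Proof.
by apply: (big_morph (cross_mul^~ x)) => [u v|]; [exact: cross_mulDl|exact: cross_mul0l].
Qed.
Lemma cross_mul_sumr I r (P : pred I) F x :
  cross_mul x (\sum_(i <- r | P i) F i) = \sum_(i <- r | P i) cross_mul x (F i).
Proof.
by apply: (big_morph (cross_mul x)) => [u v|]; [exact: cross_mulDr|exact: cross_mul0r].
Qed.

Lemma cross_mulA : associative cross_mul.
Proof.
move=> x y z; elim/cross_ind: x => [m a|x x' IHx IHx']; last first.
  by rewrite !cross_mulDl IHx IHx'.
elim/cross_ind: y => [m' a'|y y' IHy IHy']; last first.
  by rewrite !(cross_mulDl, cross_mulDr) IHy IHy'.
elim/cross_ind: z => [m'' a''|z z' IHz IHz']; last first.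
  by rewrite !cross_mulDr IHz IHz'.
pose f x1 x2 y := \sw_(c1, c2 <- Δ a')
  ((m * ((x1 ▷ m') * (x2 ▷ (c1 ▷ m'')))) ⋊ (y * (c2 * a''))).
symmetry; rewrite !cross_mul_cp cross_mul_suml cross_mul_sumr.
transitivity (\sw_(x, y <- Δ a) \sw_(y1, y2 <- Δ y) f x y1 y2).
  apply: eq_bigr => i _; rewrite cross_mul_cp copME; last exact: mul_bal4.
  apply: eq_bigr => j _; apply: eq_bigr => k _.
  by rewrite actA !mulrA.
rewrite -coassocE; first last.
- move=> x; split=> *; rewrite -?big_split; apply: eq_bigr => i _.
  + by rewrite actDl !mulrDr (balDl cp_bal).
  + by rewrite mulrDl (balDr cp_bal).
  + by rewrite actZl -!scalerAr -scalerAl (balZ cp_bal).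
- move=> z; split=> *; rewrite -?big_split; apply: eq_bigr => i _.
  + by rewrite actDl mulrDl mulrDr (balDl cp_bal).
  + by rewrite actDl !mulrDr (balDl cp_bal).
  + by rewrite !actZl -scalerAl -!scalerAr.
under [RHS]eq_bigr => i _ do rewrite cross_mul_cp.
rewrite [RHS]exchange_big; apply: eq_bigr => j _ /=.
rewrite /f exchange_tsum; apply: eq_bigr => i _.
rewrite actM mulr_sumr; symmetry.
exact: (big_morph (cp^~ (vb j * (vb i * a''))) (fun u v => balDl cp_bal u v _)
  (bal0l _ (balDl cp_bal))).
Qed.

Lemma cross_mul1l : left_id (1 ⋊ 1) cross_mul.
Proof.
elim/cross_ind=> [m a|x y IHx IHy]; last by rewrite cross_mulDr IHx IHy.
rewrite cross_mul_cp.
pose b j := \sw_(x, y <- Δ 1) (vcoord j x *: y).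
have bL j : leftA H (b j).
  exists (dual_of H (vcoord j)); apply: eq_tsum => x y; congr (_ *: _).
  rewrite -[RHS]/(⟨ dual_of H (vcoord j) | x ⟩) dual_ofE // => c u v.
  by rewrite vcoordD vcoordZ.
have B : balanced (fun x y => ((x ▷ m) * (y ▷ 1)) ⋊ a).
  split=> *; rewrite ?actDl ?mulrDl ?mulrDr ?(balDl cp_bal) //.
  by rewrite !actZl -scalerAl -scalerAr.
have B1 := mul_bal4 1 m a.
have tl : Δ 1 = \sum_j vb j ⊗ b j by exact: tens_legs.
clearbody b; rewrite tl tsum_sum; last exact: balDl B1.
transitivity (\sw_(x, y <- Δ 1) (((x ▷ m) * (y ▷ 1)) ⋊ a)).
  rewrite tl tsum_sum; last exact: balDl B.
  apply: eq_bigr => j _; rewrite (tsum_tens _ _ B1) (tsum_tens _ _ B).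
  by rewrite mul1r cp_leftA.
rewrite -[RHS](congr1 (cp^~ a) (act1 K m)) -[in RHS](mulr1 m) actM.
exact/esym/(big_morph (cp^~ a) (fun u v => balDl cp_bal u v _)
    (bal0l _ (balDl cp_bal))).
Qed.

Lemma cross_mul1r : right_id (1 ⋊ 1) cross_mul.
Proof.
elim/cross_ind=> [m a|x y IHx IHy]; last by rewrite cross_mulDl IHx IHy.
by rewrite cross_mul_cp cp_epsL mulr1.
Qed.

(* m ⋊ a |-> m (a ▷ 1), a left inverse of the embedding m |-> m ⋊ 1 *)
Definition cross_retract (x : crossed) : M := \sw_(m, a <- repr x) (m * (a ▷ 1)).

Lemma cross_retract_cp m a : cross_retract (m ⋊ a) = m * (a ▷ 1).
Proof.
have B : balanced (fun m a => m * (a ▷ 1)).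
  split=> *; rewrite ?actDl ?mulrDl ?mulrDr //.
  by rewrite !actZl -scalerAl -scalerAr.
rewrite -[RHS](tsum_tens m a B).
apply: (@cross_factor _ (fun t => tsum t _)) => [s t|n b c bL|].
- by apply: tsumD; exact: balDl B.
- by rewrite !(tsum_tens _ _ B) actA (act_leftA _ bL) mulrA.
- exact: cpi_repr.
Qed.

Lemma cross_embK : cancel (fun m => m ⋊ 1) cross_retract.
Proof. by move=> m; rewrite cross_retract_cp act1 mulr1. Qed.

Lemma cross_one_neq0 : 1 ⋊ 1 != 0.
Proof.
apply/eqP => e; have := oner_neq0 M; rewrite -(cross_embK 1) e.
have -> : 0 = 0 ⋊ 1 by rewrite (bal0l _ (balDl cp_bal)).
by rewrite cross_embK eqxx.
Qed.

HB.instance Definition _ := GRing.Zmodule_isNzRing.Build crossed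
  cross_mulA cross_mul1l cross_mul1r cross_mulDl cross_mulDr cross_one_neq0.

Lemma cpM m a m' a' :
  (m ⋊ a) * (m' ⋊ a') = \sw_(x, y <- Δ a) ((m * (x ▷ m')) ⋊ (y * a')).
Proof. exact: cross_mul_cp. Qed.

Lemma cp1 : 1 ⋊ 1 = 1.
Proof. by []. Qed.

Lemma cross_scaleAl (c : C) (x y : crossed) : c *: (x * y) = (c *: x) * y.
Proof.
elim/cross_ind: x => [m a|x x' IHx IHx']; last first.
  by rewrite mulrDl !scalerDr IHx IHx' mulrDl.
elim/cross_ind: y => [m' a'|y y' IHy IHy']; last first.
  by rewrite !mulrDr !scalerDr IHy IHy'.
rewrite -cpZl !cpM /tsum scaler_sumr; apply: eq_bigr => i _.
by rewrite -cpZl scalerAl.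
Qed.

Lemma cross_scaleAr (c : C) (x y : crossed) : c *: (x * y) = x * (c *: y).
Proof.
elim/cross_ind: x => [m a|x x' IHx IHx']; last first.
  by rewrite mulrDl !scalerDr IHx IHx' mulrDl.
elim/cross_ind: y => [m' a'|y y' IHy IHy']; last first.
  by rewrite scalerDr !mulrDr scalerDr IHy IHy'.
rewrite -cpZl !cpM /tsum scaler_sumr; apply: eq_bigr => i _.
by rewrite -cpZl actZr -!scalerAr.
Qed.

HB.instance Definition _ := GRing.Lmodule_isLalgebra.Build C crossed cross_scaleAl.
HB.instance Definition _ := GRing.Lalgebra_isAlgebra.Build C crossed cross_scaleAr.

Lemma hitD (phi : dual H) a b : hit H phi (a + b) = hit H phi a + hit H phi b.
Proof.
rewrite /hit copD tsumD // => u u' v; exact: scalerDr.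
Qed.

Lemma hitZ (phi : dual H) c a : hit H phi (c *: a) = c *: hit H phi a.
Proof.
rewrite /hit copZ [RHS]scaler_sumr; apply: eq_bigr => i _.
by rewrite ffunE !scalerA mulrC.
Qed.

Lemma hit_leftA (phi : dual H) b a :
  leftA H b -> hit H phi (b * a) = b * hit H phi a.
Proof.
move=> bL; rewrite /hit (cop_leftMlE _ bL); last first.
  split=> [u u' v|u v v'|c u v]; first by rewrite scalerDr.
    by rewrite -scalerDl; congr (_ *: _); apply: (pairDr phi).
  by rewrite scalerA mulrC; congr (_ *: _); apply/esym/(pairZr phi).
by rewrite [RHS]mulr_sumr; apply: eq_bigr => i _; rewrite scalerAr.
Qed.

(* the action of the dual, φ ▷ (m ⋊ a) = m ⋊ (φ ⇀ a), see dact_cp *)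
Definition dact (phi : dual H) (x : crossed) : crossed :=
  \sw_(m, a <- repr x) (m ⋊ hit H phi a).

Lemma dact_cp phi m a : dact phi (m ⋊ a) = m ⋊ hit H phi a.
Proof.
have B : balanced (fun m a => m ⋊ hit H phi a).
  split=> *; rewrite ?hitD ?hitZ ?(balDl cp_bal) ?(balDr cp_bal) //.
  by rewrite (balZ cp_bal).
rewrite -[RHS](tsum_tens m a B).
apply: (@cross_factor _ (fun t => tsum t _)) => [s t|n b c bL|].
- by apply: tsumD; exact: balDl B.
- by rewrite !(tsum_tens _ _ B) (hit_leftA _ _ bL) cp_leftA.
- exact: cpi_repr.
Qed.

Definition crossedR : set crossed := [set x | exists phi, x = dact phi 1].

(* the map Ê_φ, with M identified with M ⋊ 1 *)
Definition Ehat (phi : dual H) : crossed -> crossed := dact phi.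

Lemma EhatE phi m a : Ehat phi (m ⋊ a) = m ⋊ hit H phi a.
Proof. exact: dact_cp. Qed.

End ModuleAlgebra.

Arguments crossedR {C A H M} K.

(* Main.v *)
Require Import Defs.
From HB Require Import structures.
From mathcomp Require Import all_boot all_order all_algebra all_field.
From mathcomp Require Import boolp classical_sets reals complex.

(* The dual pair gives explicit access to the antipode: since l is a left
   integral, l_(1) ⊗ a l_(2) = S(a) l_(1) ⊗ l_(2), and applying λ to the second
   leg yields S(a) = l_(1) <λ|a l_(2)>.  Hence S is antimultiplicative and
   bijective, and together with y_(1) <λ|x y_(2)> = S(x_(1)) <λ|x_(2) y> it is
   anticomultiplicative.  The quasi-basis identity for λ ⇀ _ on A then reduces to
   l_(2) S^-1(l_(1)) <λ|l_(3)> = S^-1(λ ⇀ l) = 1; the other half follows from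
   the nondegeneracy of λ.  It passes to M ⋊ A because M ⋊ A is spanned by the
   products (1 ⋊ a)(m ⋊ 1).  Legs of λ give a quasi-basis for l ⇀ _ on the dual,
   so that Ind l = n_R(λ) = z ⇀ 1 with z = λ ⇀ 1.  When Ind l is central and
   also lies in the left subalgebra of the dual, z is central in A. *)

Import Order.TTheory GRing.Theory Num.Theory.
Local Open Scope ring_scope.
Local Open Scope classical_set_scope.
Local Open Scope complex_scope.

Set Implicit Arguments.
Unset Strict Implicit.
Unset Printing Implicit Defensive.

(** * Calculus of balanced maps and Sweedler sums *)

Section Balanced.
Context {F : fieldType}.
Implicit Types (U : lmodType F) (V : vectType F) (W : zmodType).

Lemma bal_suml U V W (f : U -> V -> W) v I r (P : pred I) (u : I -> U) :
  balanced f ->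
  f (\sum_(i <- r | P i) u i) v = \sum_(i <- r | P i) f (u i) v.
Proof.
move=> fB; apply: (big_morph (f^~ v)) => [x y|]; first exact: balDl fB _ _ _.
exact: bal0l (balDl fB).
Qed.

Lemma bal_sumr U V W (f : U -> V -> W) u I r (P : pred I) (v : I -> V) :
  balanced f ->
  f u (\sum_(i <- r | P i) v i) = \sum_(i <- r | P i) f u (v i).
Proof.
move=> fB; apply: (big_morph (f u)) => [x y|]; first exact: balDr fB _ _ _.
exact: bal0r (balDr fB).
Qed.

Lemma bal_tsuml U V W (f : U -> V -> W) v (U' : lmodType F) (V' : vectType F)
    (t : tensor U' V') (g : U' -> V' -> U) :
  balanced f -> f (\sw_(x, y <- t) g x y) v = \sw_(x, y <- t) f (g x y) v.
Proof. exact: bal_suml. Qed.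

Lemma bal_tsumr U V W (f : U -> V -> W) u (U' : lmodType F) (V' : vectType F)
    (t : tensor U' V') (g : U' -> V' -> V) :
  balanced f -> f u (\sw_(x, y <- t) g x y) = \sw_(x, y <- t) f u (g x y).
Proof. exact: bal_sumr. Qed.

Lemma bal_tsum U V W (U' : lmodType F) (V' : vectType F) (t : tensor U' V')
    (f : U -> V -> U' -> V' -> W) :
  (forall x' y', balanced (fun x y => f x y x' y')) ->
  balanced (fun x y => \sw_(x', y' <- t) f x y x' y').
Proof.
move=> fB; split=> *; rewrite -?big_split; apply: eq_bigr => i _.
- exact: balDl (fB _ _) _ _ _.
- exact: balDr (fB _ _) _ _ _.
- exact: balZ (fB _ _) _ _ _.
Qed.

Lemma bal_swap (V V' : vectType F) W (f : V -> V' -> W) :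
  balanced f -> balanced (fun x y => f y x).
Proof.
move=> fB; split=> *; [exact: balDr fB _ _ _|exact: balDl fB _ _ _|].
by rewrite (balZ fB).
Qed.

Lemma bal_comp U V (U' : lmodType F) (V' : vectType F) W (f : U' -> V' -> W)
    (g : U -> U') (h : V -> V') :
  balanced f -> linear g -> linear h -> balanced (fun x y => f (g x) (h y)).
Proof.
have lD (X Y : lmodType F) (k : X -> Y) :
    linear k -> forall x y, k (x + y) = k x + k y.
  by move=> kL x y; have := kL 1 x y; rewrite !scale1r.
have lZ (X Y : lmodType F) (k : X -> Y) :
    linear k -> forall c x, k (c *: x) = c *: k x.
  move=> kL c x; have k0 : k 0 = 0.
    by apply: (addIr (k 0)); rewrite -lD // !add0r.
  by have := kL c x 0; rewrite k0 !addr0.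
move=> fB gL hL; split=> *; rewrite ?(lD _ _ _ gL) ?(lD _ _ _ hL).
- exact: balDl fB _ _ _.
- exact: balDr fB _ _ _.
- by rewrite (lZ _ _ _ gL) (lZ _ _ _ hL) (balZ fB).
Qed.

(** [tsum] uses the canonical expansion of a tensor. Here any expansion will do, as needed for
    quasi-bases read off from an arbitrary expansion of Δ(l). *)
Lemma tsum_expand U V W (f : U -> V -> W) (s : seq (U * V)) (t : tensor U V) :
  balanced f -> t = \sum_(p <- s) p.1 ⊗ p.2 ->
  tsum t f = \sum_(p <- s) f p.1 p.2.
Proof.
move=> fB ->; rewrite tsum_sum; last exact: balDl fB.
by apply: eq_bigr => p _; rewrite tsum_tens.
Qed.

Lemma linear_mull (B : algType F) (a : B) : linear ( *%R a).
Proof. by move=> c u v; rewrite mulrDr scalerAr. Qed.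

Lemma linear_mulr (B : algType F) (a : B) : linear ( *%R^~ a).
Proof. by move=> c u v; rewrite mulrDl scalerAl. Qed.

Lemma bal_compl U V (U' : lmodType F) W (f : U' -> V -> W) (g : U -> U') :
  balanced f -> linear g -> balanced (fun x y => f (g x) y).
Proof. by move=> fB gL; apply: (@bal_comp _ _ _ _ _ f g id fB gL). Qed.

Lemma bal_compr U V (V' : vectType F) W (f : U -> V' -> W) (h : V -> V') :
  balanced f -> linear h -> balanced (fun x y => f x (h y)).
Proof. by move=> fB hL; apply: (@bal_comp _ _ _ _ _ f id h fB _ hL). Qed.

Lemma bal_lmull (B : algType F) V W (f : B -> V -> W) (a : B) :
  balanced f -> balanced (fun x y => f (a * x) y).
Proof. by move=> fB; apply: (bal_compl fB); exact: linear_mull. Qed.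

Lemma bal_lmulr (B : algType F) V W (f : B -> V -> W) (a : B) :
  balanced f -> balanced (fun x y => f (x * a) y).
Proof. by move=> fB; apply: (bal_compl fB); exact: linear_mulr. Qed.

Lemma bal_rmull U (B : falgType F) W (f : U -> B -> W) (a : B) :
  balanced f -> balanced (fun x y => f x (a * y)).
Proof. by move=> fB; apply: (bal_compr fB); exact: linear_mull. Qed.

Lemma bal_rmulr U (B : falgType F) W (f : U -> B -> W) (a : B) :
  balanced f -> balanced (fun x y => f x (y * a)).
Proof. by move=> fB; apply: (bal_compr fB); exact: linear_mulr. Qed.

End Balanced.

(** * Counital maps and left integrals in A *)

Section WeakHopf.
Context {C : numClosedFieldType} {A : falgType C}.
Variable H : weakCHopf A.
Local Notation Δ := (cop H).
Local Notation ε := (cou H : A -> C).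
Local Notation S := (anti H).
Implicit Types (a b x y : A) (phi : dual H) (W : zmodType).

Lemma couD x y : ε (x + y) = ε x + ε y.
Proof. exact: (pairDr (cou H : dual H)). Qed.

Lemma couZ c x : ε (c *: x) = c * ε x.
Proof. exact: (pairZr (cou H : dual H)). Qed.

Lemma antiD x y : S (x + y) = S x + S y.
Proof. exact: linearD. Qed.

Lemma antiZ c x : S (c *: x) = c *: S x.
Proof. exact: linearZ. Qed.

Lemma linear_anti : linear S.
Proof. exact: linearP. Qed.

Lemma anti_tsum (t : tensor A A) (f : A -> A -> A) :
  S (\sw_(x, y <- t) f x y) = \sw_(x, y <- t) S (f x y).
Proof. exact: linear_sum. Qed.

Lemma cou_tsum (t : tensor A A) (f : A -> A -> A) :
  ε (\sw_(x, y <- t) f x y) = \sw_(x, y <- t) ε (f x y).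
Proof. exact: (linear_sum (cou H)). Qed.

Lemma pair_balr phi : balanced (fun x y => ⟨ phi | y ⟩ *: x).
Proof.
split=> [u u' v|u v v'|c u v]; rewrite ?scalerDr ?pairDr ?scalerDl //.
by rewrite pairZr !scalerA mulrC.
Qed.

Lemma pair_ball phi : balanced (fun x y => ⟨ phi | x ⟩ *: y).
Proof. by apply: (@bal_swap _ A A _ (fun x y => _)); exact: pair_balr. Qed.

Lemma hitE phi a : hit H phi a = \sw_(x, y <- Δ a) (⟨ phi | y ⟩ *: x).
Proof. by []. Qed.

(** Trades a pairing with φ for the map φ ⇀ _, whose linearity over A_L can then be used. *)
Lemma cou_hit phi a : ε (hit H phi a) = ⟨ phi | a ⟩.
Proof.
rewrite hitE cou_tsum -[in RHS](wh_counitl (wh_axioms H) a) pair_tsum.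
by apply: eq_tsum => x y; rewrite couZ pairZr mulrC.
Qed.

Lemma leftAP b : leftA H b <->
  exists phi : dual H, b = \sw_(x, y <- Δ 1) (⟨ phi | x ⟩ *: y).
Proof. by []. Qed.

Lemma leftAD a b : leftA H a -> leftA H b -> leftA H (a + b).
Proof.
move=> /leftAP[phi ->] /leftAP[psi ->]; apply/leftAP; exists (phi + psi).
by rewrite -big_split; apply: eq_bigr => i _; rewrite pairDl scalerDl.
Qed.

Lemma leftAZ c a : leftA H a -> leftA H (c *: a).
Proof.
move=> /leftAP[phi ->]; apply/leftAP; exists (c *: phi).
by rewrite /tsum scaler_sumr; apply: eq_bigr => i _; rewrite pairZl scalerA.
Qed.

Lemma leftA0 : leftA H 0.
Proof.
apply/leftAP; exists 0; rewrite /tsum big1 // => i _.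
by rewrite pair0l scale0r.
Qed.

Lemma leftA_sum I r (P : pred I) (f : I -> A) :
  (forall i, P i -> leftA H (f i)) -> leftA H (\sum_(i <- r | P i) f i).
Proof. by move=> fL; apply: big_ind => //; [exact: leftA0|exact: leftAD]. Qed.

(* The second legs of Δ(1) lie in A_L. *)
Lemma eq_tsum1 W (f g : A -> A -> W) : balanced f -> balanced g ->
  (forall x b, leftA H b -> f x b = g x b) ->
  \sw_(x, y <- Δ 1) f x y = \sw_(x, y <- Δ 1) g x y.
Proof.
move=> fB gB fg; rewrite (tens_legs (Δ 1)) !tsum_sum; last first.
- exact: balDl fB.
- exact: balDl gB.
apply: eq_bigr => j _; rewrite !tsum_tens //; apply: fg; apply/leftAP.
exists (dual_of H (vcoord j)); apply: eq_tsum => x y; congr (_ *: _).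
by rewrite dual_ofE // => c u v; rewrite vcoordD vcoordZ.
Qed.

Definition epsR a : A := \sw_(x, y <- Δ a) (S x * y).

Lemma epsRE a : epsR a = \sw_(x, y <- Δ 1) (ε (a * y) *: x).
Proof. exact: (wh_antil (wh_axioms H)). Qed.

Lemma couD_leftA a b : leftA H b ->
  \sw_(x, y <- Δ a) (ε (x * b) *: y) = a * b.
Proof.
move=> bL; rewrite -[RHS](wh_counitl (wh_axioms H)).
by rewrite (cop_leftMrE _ bL (cou_bal H)).
Qed.

(** The counit formula for [epsR] gives 1_(1) ⊗ ε(a_(1) 1_(2)) a_(2). The second legs of Δ(1) lie in
    A_L, so [couD_leftA] turns the last factor into a 1_(2). *)
Lemma epsR_legs W (f : A -> A -> W) a : balanced f ->
  \sw_(x, y <- Δ a) f (epsR x) y = \sw_(x, y <- Δ 1) f x (a * y).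
Proof.
move=> fB.
transitivity (\sw_(x, y <- Δ 1) \sw_(p, q <- Δ a) f x (ε (p * y) *: q)).
  rewrite exchange_tsum; apply: eq_tsum => p q.
  by rewrite epsRE bal_tsuml //; apply: eq_tsum => x y; rewrite (balZ fB).
apply: eq_tsum1 => [||x b bL].
- apply: bal_tsum => p q; split=> *.
  + exact: balDl fB _ _ _.
  + by rewrite mulrDr couD scalerDl (balDr fB).
  + by rewrite (balZ fB) scalerA -scalerAr couZ.
- exact: bal_rmull.
by rewrite -bal_tsumr // couD_leftA.
Qed.

Lemma anti_epsL a : \sw_(x, y <- Δ a) (S x * epsL H y) = S a.
Proof.
rewrite -[RHS](wh_anti3 (wh_axioms H)); apply: eq_tsum => x y.
by rewrite /epsL /tsum mulr_sumr; apply: eq_bigr => i _; rewrite mulrA.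
Qed.

Lemma cou_sum I r (P : pred I) (f : I -> A) :
  ε (\sum_(i <- r | P i) f i) = \sum_(i <- r | P i) ε (f i).
Proof. exact: (linear_sum (cou H)). Qed.

Lemma cou_epsL a : ε (epsL H a) = ε a.
Proof.
rewrite epsLE cou_sum -[in RHS](mul1r a).
rewrite -[in RHS](wh_counitr (wh_axioms H) 1) [in RHS]/tsum mulr_suml.
rewrite cou_sum; apply: eq_bigr => i _.
by rewrite -scalerAl !couZ mulrC.
Qed.

Lemma cou_epsR a : ε (epsR a) = ε a.
Proof.
rewrite epsRE cou_sum -[in RHS](mulr1 a).
rewrite -[in RHS](wh_counitl (wh_axioms H) 1) [in RHS]/tsum mulr_sumr.
rewrite cou_sum; apply: eq_bigr => i _.
by rewrite -scalerAr !couZ mulrC.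
Qed.

Lemma linear_epsL : linear (epsL H).
Proof.
move=> c u v; rewrite /epsL linearP tsumD => [|*]; last by rewrite mulrDl.
congr (_ + _); rewrite /tsum scaler_sumr; apply: eq_bigr => i _.
by rewrite ffunE scalerAl.
Qed.

Lemma epsLD a b : epsL H (a + b) = epsL H a + epsL H b.
Proof. by have := linear_epsL 1 a b; rewrite !scale1r. Qed.

Lemma epsLZ c a : epsL H (c *: a) = c *: epsL H a.
Proof.
have eL0 : epsL H 0 = 0 by apply: (addIr (epsL H 0)); rewrite -epsLD !add0r.
by have := linear_epsL c a 0; rewrite eL0 !addr0.
Qed.

(** Weak multiplicativity of ε with 1 inserted between a and b: ε(u a b) = ε(u a 1_(1)) ε(1_(2)
    b). *)
Lemma epsL_mul a b :
  epsL H (a * b) = \sw_(x, y <- Δ 1) (ε (y * b) *: epsL H (a * x)).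
Proof.
rewrite epsLE.
transitivity (\sw_(u, v <- Δ 1) \sw_(x, y <- Δ 1)
    ((ε (u * a * x) * ε (y * b)) *: v)).
  apply: eq_tsum => u v; rewrite -[in LHS](mulr1 a) !mulrA.
  by rewrite (wh_couM (wh_axioms H)) /tsum scaler_suml.
rewrite exchange_tsum; apply: eq_tsum => x y.
rewrite epsLE /tsum scaler_sumr; apply: eq_bigr => i _.
by rewrite mulrC scalerA mulrA.
Qed.

Lemma couD_leftAl a b : leftA H b ->
  \sw_(x, y <- Δ a) (ε (b * x) *: y) = b * a.
Proof.
move=> bL; rewrite -[RHS](wh_counitl (wh_axioms H)).
by rewrite (cop_leftMlE _ bL (cou_bal H)).
Qed.

(** In Δ(x)Δ(y), [epsL_mul] replaces y_(1) by the coefficient ε(1_(2) y_(1)), which the second leg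
    absorbs as 1_(2) y. The factor Δ(1) that remains disappears into Δ(x). *)
Lemma epsL_legs W (f : A -> A -> W) x y : balanced f ->
  \sw_(p, q <- Δ (x * y)) f (epsL H p) q =
  \sw_(p, q <- Δ x) f (epsL H p) (q * y).
Proof.
move=> fB; have fLB : balanced (fun p q => f (epsL H p) q).
  exact: (bal_compl fB linear_epsL).
have fyB : balanced (fun p q => f (epsL H p) (q * y)).
  exact: (bal_rmulr _ fLB).
rewrite copME // -[in RHS](mulr1 x) copME //; apply: eq_tsum => p q.
transitivity (\sw_(x', y' <- Δ 1) \sw_(a, b <- Δ y)
    f (epsL H (p * x')) (ε (y' * a) *: (q * b))).
  rewrite exchange_tsum; apply: eq_tsum => a b.
  rewrite epsL_mul bal_tsuml //; apply: eq_tsum => u v.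
  by rewrite (balZ fB).
apply: eq_tsum1 => [||u b bL].
- apply: bal_tsum => a b; split=> *.
  + by rewrite mulrDr (balDl fLB).
  + by rewrite mulrDl couD scalerDl (balDr fB).
  + by rewrite -scalerAr (balZ fLB) -scalerAl couZ scalerA.
- split=> *.
  + by rewrite mulrDr (balDl fLB).
  + by rewrite mulrDr mulrDl (balDr fB).
  + by rewrite -scalerAr (balZ fLB) -scalerAr -scalerAl.
rewrite -bal_tsumr //; congr (f _ _).
rewrite -mulrA -(couD_leftAl y bL) /tsum mulr_sumr.
by apply: eq_bigr => i _; rewrite scalerAr.
Qed.

Lemma nondegenerate_dual_inj (lam : dual H) a b : nondegenerate_dual lam ->
  (forall y, ⟨ lam | y * a ⟩ = ⟨ lam | y * b ⟩) -> a = b.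
Proof.
case=> _ nd ab; apply/eqP; rewrite -subr_eq0; apply/eqP/nd => y.
by rewrite mulrDr mulrN pairDr ab -pairDr subrr pair0r.
Qed.

Section LeftIntegral.
Variable l : A.
Hypothesis l_int : left_integral H l.

(** Write Δ(l) = Δ(1)Δ(l) and 1_(1) ⊗ a 1_(2) = S(a_(1)) a_(2) ⊗ a_(3). The last two legs of a now
    multiply Δ(l), giving Δ(a_(2) l) = Δ([epsL] a_(2) l), and S(a_(1)) [epsL](a_(2)) collapses to
    S(a). *)
Lemma integral_anti W (f : A -> A -> W) a : balanced f ->
  \sw_(x, y <- Δ l) f x (a * y) = \sw_(x, y <- Δ l) f (S a * x) y.
Proof.
move=> fB.
have faB u v : balanced (fun x y => f (u * x) (v * y)).
  by apply: bal_comp; [|exact: linear_mull|exact: linear_mull].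
have fxB x y : balanced (fun u v => f (u * x) (v * y)).
  by apply: (bal_comp fB); exact: linear_mulr.
have FB : balanced (fun u v => \sw_(x, y <- Δ l) f (u * x) (v * y)).
  by apply: bal_tsum.
transitivity (\sw_(u, v <- Δ 1) \sw_(x, y <- Δ l) f (u * x) ((a * v) * y)).
  rewrite -[in LHS](mul1r l) copME; last first.
    exact: bal_rmull.
  by apply: eq_tsum => u v; apply: eq_tsum => x y; rewrite mulrA.
rewrite -(epsR_legs _ FB).
pose G u v w := \sw_(x, y <- Δ l) f (S u * v * x) (w * y).
transitivity (\sw_(p, q <- Δ a) \sw_(u, v <- Δ p) G u v q).
  apply: eq_tsum => p q; rewrite /G exchange_tsum; apply: eq_tsum => x y.
  rewrite /epsR -(bal_tsuml _ _ _ (fxB x y)).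
  by [].
rewrite coassocE; first last.
- move=> u; apply: bal_tsum => x y; split=> *.
  + by rewrite mulrDr mulrDl (balDl fB).
  + by rewrite mulrDl (balDr fB).
  + by rewrite -scalerAr -!scalerAl (balZ fB).
- move=> w; apply: bal_tsum => x y; split=> *.
  + by rewrite antiD !mulrDl (balDl fB).
  + by rewrite mulrDr mulrDl (balDl fB).
  + by rewrite antiZ -scalerAl -scalerAr.
transitivity (\sw_(p, q <- Δ a) \sw_(x, y <- Δ l) f (S p * epsL H q * x) y).
  apply: eq_tsum => p q; rewrite /G.
  transitivity (\sw_(x, y <- Δ (q * l)) f (S p * x) y).
    rewrite copME; last exact: bal_lmull.
    by apply: eq_tsum => u v; apply: eq_tsum => x y; rewrite mulrA.
  rewrite l_int (cop_leftMlE _ (epsL_leftA H q)); last first.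
    exact: bal_lmull.
  by apply: eq_tsum => x y; rewrite mulrA.
rewrite exchange_tsum; apply: eq_tsum => x y.
have xB : balanced (fun u v => f (u * x) v).
  exact: bal_lmulr.
by rewrite -(bal_tsuml _ _ _ xB) anti_epsL.
Qed.

End LeftIntegral.

End WeakHopf.

(** * Left integrals of the dual, read as identities in A *)

Section DualIntegral.
Context {C : numClosedFieldType} {A : falgType C}.
Variable H : weakCHopf A.
Local Notation Δ := (cop H).
Local Notation ε := (cou H : A -> C).
Local Notation S := (anti H).
Local Notation D := (dual_data H).
Implicit Types (a b x y : A) (phi psi : dual H) (W : zmodType).

Lemma pair_suml I r (P : pred I) (f : I -> dual H) x :
  ⟨ \sum_(i <- r | P i) f i | x ⟩ = \sum_(i <- r | P i) ⟨ f i | x ⟩.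
Proof.
apply: (big_morph (fun phi : dual H => ⟨ phi | x ⟩)); last exact: pair0l.
by move=> phi psi; exact: pairDl.
Qed.

Lemma pair_sumr phi I r (P : pred I) (f : I -> A) :
  ⟨ phi | \sum_(i <- r | P i) f i ⟩ = \sum_(i <- r | P i) ⟨ phi | f i ⟩.
Proof. exact: (big_morph _ (pairDr phi) (pair0r phi)). Qed.

Lemma dual_sep x y : (forall phi, ⟨ phi | x ⟩ = ⟨ phi | y ⟩) -> x = y.
Proof.
move=> xy; rewrite -(vb_sum x) -(vb_sum y); apply: eq_bigr => i _.
have vL : linear_for *%R (vcoord i : A -> C).
  by move=> c u v; rewrite vcoordD vcoordZ.
by have := xy (dual_of H (vcoord i)); rewrite !dual_ofE // => ->.
Qed.

(** Product and coproduct exchange roles under the pairing. This carries the integral equation of λ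
    over to A. *)
Lemma pair_dual_epsL phi x : ⟨ epsL D phi | x ⟩ = ⟨ phi | epsL H x ⟩.
Proof.
rewrite /epsL pair_tsum pair_suml.
under eq_bigr => i _ do rewrite dualME.
under eq_bigr => i _ do under eq_tsum => u v do rewrite dual_antiE.
rewrite exchange_big; apply: eq_bigr => j _.
exact: (dual_copE phi ((Δ x) j) (S (vb j))).
Qed.

Variable lam : dual H.
Hypothesis lam_int : left_integral D lam.

(** Paired with φ, the two sides are φλ and [epsL](φ)λ evaluated at a. *)
Lemma hit_integral a :
  hit H lam a = \sw_(p, q <- Δ a) (⟨ lam | q ⟩ *: epsL H p).
Proof.
apply: dual_sep => phi; rewrite hitE !pair_tsum.
under eq_tsum => x y do rewrite pairZr mulrC.
under [RHS]eq_tsum => x y do rewrite pairZr mulrC -pair_dual_epsL.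
by rewrite -!dualME lam_int.
Qed.

Lemma hit_integral_leftA a : leftA H (hit H lam a).
Proof.
rewrite hit_integral; apply: leftA_sum => i _.
by apply: leftAZ; apply: epsL_leftA.
Qed.

(** Counterpart of [integral_anti] for λ. Inserting Δ(1) in front of Δ(y) produces S(x_(1)) (λ ⇀
    x_(2) y); then [hit_integral] and [epsL_legs] give S(x_(1)) [epsL](x_(2)) <λ|x_(3) y>, whose
    first two factors collapse to the antipode. *)
Lemma integral_swap x y :
  \sw_(p, q <- Δ y) (⟨ lam | x * q ⟩ *: p) =
  \sw_(p, q <- Δ x) (⟨ lam | q * y ⟩ *: S p).
Proof.
have B0 := pair_balr lam.
pose F (p q u v : A) : A := ⟨ lam | v * q ⟩ *: (u * p).
have F1 u v : balanced (fun p q => F p q u v).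
  split=> *; rewrite /F ?mulrDr ?pairDr ?scalerDl ?scalerDr //.
  by rewrite -!scalerAr pairZr !scalerA mulrC.
have F2 p q : balanced (F p q).
  split=> *; rewrite /F ?mulrDl ?pairDr ?scalerDl ?scalerDr //.
  by rewrite -!scalerAl pairZr !scalerA mulrC.
transitivity (\sw_(u, v <- Δ 1) \sw_(p, q <- Δ y) F p q u (x * v)).
  rewrite -[in LHS](mul1r y) copME; last exact: (bal_rmull _ B0).
  by apply: eq_tsum => u v; apply: eq_tsum => p q; rewrite /F mulrA.
have FB : balanced (fun u v => \sw_(p, q <- Δ y) F p q u v).
  by apply: bal_tsum => p q.
rewrite -(epsR_legs H x FB).
pose G (u v w : A) : A := \sw_(p, q <- Δ y) F p q (S u * v) w.
transitivity (\sw_(p, q <- Δ x) \sw_(u, v <- Δ p) G u v q).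
  apply: eq_tsum => a b; rewrite /G exchange_tsum; apply: eq_tsum => p q.
  by rewrite -(bal_tsuml _ _ _ (F2 p q)).
rewrite coassocE; first last.
- move=> u; apply: bal_tsum => p q.
  by split=> *; rewrite ?mulrDr ?(balDl (F2 _ _)) ?(balDr (F2 _ _)) // -scalerAr
     (balZ (F2 _ _)).
- move=> w; apply: bal_tsum => p q.
  split=> *; rewrite ?antiD ?mulrDr ?mulrDl ?(balDl (F2 _ _)) //.
  by rewrite antiZ -scalerAl -scalerAr.
pose K (u v w : A) : A := ⟨ lam | w * y ⟩ *: (S u * epsL H v).
transitivity (\sw_(p, q <- Δ x) \sw_(u, v <- Δ q) K p u v).
  apply: eq_tsum => a b; rewrite /G /F.
  transitivity (S a * hit H lam (b * y)).
    rewrite hitE copME // /tsum mulr_sumr; apply: eq_bigr => i _.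
    rewrite mulr_sumr; apply: eq_bigr => j _.
    by rewrite -scalerAr mulrA.
  rewrite hit_integral (epsL_legs H _ _ B0) /tsum mulr_sumr.
  by apply: eq_bigr => i _; rewrite /K scalerAr.
rewrite -coassocE; first last.
- move=> u; split=> *; rewrite /K ?epsLD ?mulrDl ?mulrDr ?pairDr.
  + by rewrite scalerDr.
  + by rewrite scalerDl.
  + by rewrite epsLZ -scalerAr -scalerAl pairZr !scalerA mulrC.
- move=> w; split=> *; rewrite /K ?antiD ?epsLD ?mulrDl ?mulrDr ?scalerDr //.
  by rewrite antiZ epsLZ -scalerAl -scalerAr.
apply: eq_tsum => a b; rewrite -(anti_epsL H a) /tsum scaler_sumr.
by [].
Qed.

End DualIntegral.

(** * Antipode and quasi-bases obtained from a dual pair of integrals *)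

Section DualPair.
Context {C : numClosedFieldType} {A : falgType C}.
Variables (H : weakCHopf A) (l : A) (lam : dual H).
Hypothesis l_int : left_integral H l.
Hypothesis lam_int : left_integral (dual_data H) lam.
Hypothesis l_nondeg : nondegenerate_for H l.
Hypothesis lam_nondeg : nondegenerate_dual lam.
Hypothesis l_lam_dual : dual_integrals l lam.
Local Notation Δ := (cop H).
Local Notation ε := (cou H : A -> C).
Local Notation S := (anti H).
Local Notation S' := ((anti H)^-1)%VF.
Local Notation D := (dual_data H).
Implicit Types (a b x y : A) (phi psi : dual H) (W : zmodType).

Lemma antiE a : S a = \sw_(x, y <- Δ l) (⟨ lam | a * y ⟩ *: x).
Proof.
rewrite (integral_anti l_int _ (pair_balr lam)) -[LHS]mulr1 -l_lam_dual.
by rewrite hitE /tsum mulr_sumr; apply: eq_bigr => i _; rewrite scalerAr.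
Qed.

Lemma anti1 : S 1 = 1.
Proof.
rewrite antiE -[RHS]l_lam_dual hitE; apply: eq_tsum => x y.
by rewrite mul1r.
Qed.

Lemma antiM a b : S (a * b) = S b * S a.
Proof.
rewrite antiE; under eq_tsum => x y do rewrite -mulrA.
have B : balanced (fun x y => ⟨ lam | a * y ⟩ *: x).
  exact: (bal_rmull _ (pair_balr lam)).
rewrite (integral_anti l_int b B) [S a]antiE /tsum mulr_sumr.
by apply: eq_bigr => i _; rewrite scalerAr.
Qed.

(** Since a l = [epsL](a) l, left A_L-linearity gives λ ⇀ (a l) = [epsL](a) (λ ⇀ l) = [epsL](a), to
    which ε is applied. *)
Lemma pair_integral a : ⟨ lam | a * l ⟩ = ε a.
Proof.
rewrite -cou_hit l_int hit_leftA; last exact: epsL_leftA.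
by rewrite l_lam_dual mulr1 cou_epsL.
Qed.

Lemma cou_anti a : ε (S a) = ε a.
Proof.
rewrite antiE cou_tsum -pair_integral -[in RHS](wh_counitl (wh_axioms H) l).
rewrite [in RHS]/tsum mulr_sumr pair_sumr.
by apply: eq_bigr => i _; rewrite couZ -scalerAr pairZr mulrC.
Qed.

(** If S(c) = 0, then <φ (ψ ↼ c)|l> = <φ|S(c) l_(1)> <ψ|l_(2)> = 0 for every φ. Nondegeneracy of l
    gives ψ ↼ c = 0, and evaluation at 1 gives <ψ|c> = 0. *)
Lemma anti_inj : injective S.
Proof.
move=> a b ab; apply/eqP; rewrite -subr_eq0; apply/eqP.
have {ab} : S (a - b) = 0 by rewrite linearB /= ab subrr.
move: (a - b) => c Sc0; apply: (@dual_sep _ _ H) => psi; rewrite pair0r.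
have <- : ⟨ ract psi c | 1 ⟩ = ⟨ psi | c ⟩ by rewrite ractE mulr1.
suff -> : ract psi c = 0 by rewrite pair0l.
apply: l_nondeg.2 => phi; rewrite dualME.
under eq_tsum => x y do rewrite ractE.
rewrite (integral_anti l_int c (dual_mul_bal phi psi)) /tsum big1 // => i _.
by rewrite Sc0 mul0r pair0r mul0r.
Qed.

Lemma antiK : cancel S S'.
Proof. by apply: lker0_lfunK; apply/lker0P; exact: anti_inj. Qed.

Lemma antiVK : cancel S' S.
Proof. by apply: lker0_lfunVK; apply/lker0P; exact: anti_inj. Qed.

Lemma antiV1 : S' 1 = 1.
Proof. by rewrite -[in LHS]anti1 antiK. Qed.

Lemma antiVM a b : S' (a * b) = S' b * S' a.
Proof. by apply: anti_inj; rewrite antiM !antiVK. Qed.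

Lemma cou_antiV a : ε (S' a) = ε a.
Proof. by rewrite -cou_anti antiVK. Qed.

Lemma linear_antiV : linear S'.
Proof. exact: linearP. Qed.

(** By [antiE], Δ(S(a)) is l_(1) ⊗ l_(2) <λ|a l_(3)>. Here [integral_swap] replaces the second leg
    by S(a_(1)) <λ|a_(2) l_(2)>, and the remaining sum over l is S(a_(2)). *)
Lemma cop_antiE W (f : A -> A -> W) a : balanced f ->
  \sw_(x, y <- Δ (S a)) f x y = \sw_(x, y <- Δ a) f (S y) (S x).
Proof.
move=> fB; pose G (u v w : A) := f u (⟨ lam | a * w ⟩ *: v).
transitivity (\sw_(x, y <- Δ l) \sw_(u, v <- Δ x) G u v y).
  rewrite antiE [in LHS]linear_sum tsum_sum; last exact: balDl fB.
  apply: eq_bigr => i _; rewrite linearZ /=; apply: eq_bigr => j _.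
  by rewrite ffunE (balZ fB).
rewrite coassocE; first last.
- move=> u; split=> *; rewrite /G.
  + by rewrite scalerDr (balDr fB).
  + by rewrite mulrDr pairDr scalerDl (balDr fB).
  + by rewrite -scalerAr pairZr !scalerA mulrC.
- move=> w; split=> *; rewrite /G ?(balDl fB) ?scalerDr ?(balDr fB) //.
  by rewrite (balZ fB) !scalerA mulrC.
transitivity (\sw_(p, q <- Δ a) \sw_(x, y <- Δ l) f (⟨ lam | q * y ⟩ *: x) (S p)).
  rewrite exchange_tsum; apply: eq_tsum => x y; rewrite /G -bal_tsumr //.
  rewrite (integral_swap lam_int) bal_tsumr //.
  by apply: eq_tsum => p q; rewrite (balZ fB).
by apply: eq_tsum => p q; rewrite -bal_tsuml // -antiE.
Qed.

Lemma cop_antiVE W (f : A -> A -> W) a : balanced f ->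
  \sw_(x, y <- Δ (S' a)) f x y = \sw_(x, y <- Δ a) f (S' y) (S' x).
Proof.
move=> fB; rewrite -[in RHS](antiVK a) cop_antiE.
  by apply: eq_tsum => x y; rewrite !antiK.
apply: (@bal_comp _ A A A A _ (fun x y => f y x)); try exact: linear_antiV.
exact: bal_swap.
Qed.

Lemma cop1_anti W (f : A -> A -> W) : balanced f ->
  \sw_(x, y <- Δ 1) f x y = \sw_(x, y <- Δ 1) f (S y) (S x).
Proof. by move=> fB; rewrite -[in LHS]anti1 cop_antiE. Qed.

Lemma anti_hit1 : S (hit H lam 1) = hit H lam 1.
Proof.
have := integral_swap lam_int 1 1.
under eq_tsum => x y do rewrite mul1r.
under [RHS]eq_tsum => x y do rewrite mulr1.
move=> e; rewrite [in RHS]hitE e [in LHS]hitE anti_tsum.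
by apply: eq_tsum => x y; rewrite antiZ.
Qed.

Lemma antiV_epsR_legs W (f : A -> A -> W) a : balanced f ->
  \sw_(x, y <- Δ a) \sw_(u, v <- Δ x) f (S' v * u) y =
  \sw_(x, y <- Δ a) f (S' (epsR H x)) y.
Proof.
move=> fB; apply: eq_tsum => x y; rewrite /epsR /tsum linear_sum.
rewrite (bal_suml _ _ _ _ fB); apply: eq_bigr => i _.
by rewrite /= antiVM antiK.
Qed.

(** Surjectivity of S makes its transpose injective, so the inverse taken in the dual is a genuine
    one. *)
Lemma pair_dual_antiV phi x : ⟨ ((anti D)^-1)%VF phi | x ⟩ = ⟨ phi | S' x ⟩.
Proof.
have inj : injective (anti D).
  move=> p q e; apply: dualP => y.
  by rewrite -(antiVK y) -!dual_antiE e.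
have ker0 : lker (anti D) == 0%VS by apply/lker0P.
by rewrite -[in LHS](antiVK x) -dual_antiE (lker0_lfunVK ker0).
Qed.

(** At x, the left side is <λ|S^-1(x_(2)) x_(1)> = <λ|S^-1([epsR] x)> = ε(x 1_(2)) <λ|S^-1(1_(1))>.
    Flipping Δ(1) by S ⊗ S makes this ε(x S(λ ⇀ 1)), and λ ⇀ 1 is fixed by S. *)
Lemma dual_nR : nR D lam = lact H (hit H lam 1) 1.
Proof.
apply: dualP => x; rewrite lactE dual1E.
transitivity (\sw_(u, v <- Δ x) ⟨ lam | S' v * u ⟩).
  rewrite /nR pair_suml; under eq_bigr => i _ do rewrite dualME.
  rewrite exchange_big; apply: eq_bigr => j _.
  rewrite -dual_copE; apply: eq_bigr => i _.
  by rewrite pair_dual_antiV mulrC.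
transitivity ⟨ lam | S' (epsR H x) ⟩.
  rewrite /epsR /tsum linear_sum pair_sumr.
  by apply: eq_bigr => i _; rewrite /= antiVM antiK.
rewrite epsRE /tsum linear_sum pair_sumr.
have B : balanced (fun u v => ⟨ lam | S' (ε (x * v) *: u) ⟩).
  split=> *; first by rewrite scalerDr linearD pairDr.
    by rewrite mulrDr couD scalerDl linearD pairDr.
  by rewrite -scalerAr couZ scalerA mulrC.
rewrite -[LHS]/(\sw_(u, v <- Δ 1) ⟨ lam | S' (ε (x * v) *: u) ⟩) cop1_anti //.
rewrite -anti_hit1 hitE anti_tsum /tsum mulr_sumr cou_sum.
apply: eq_bigr => i _; rewrite linearZ /= antiK pairZr antiZ.
by rewrite -scalerAr couZ mulrC.
Qed.

Lemma hit_leftAr phi b a : leftA H b -> hit H phi (a * b) = hit H phi a * b.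
Proof.
move=> bL; rewrite !hitE (cop_leftMrE _ bL (pair_balr phi)).
by rewrite [RHS]mulr_suml; apply: eq_bigr => i _; rewrite scalerAl.
Qed.

Lemma linear_hit phi : linear (hit H phi).
Proof. by move=> c x y; rewrite hitD hitZ. Qed.

Lemma mul_antiV_bal : balanced (fun x y => y * S' x).
Proof.
apply: bal_swap; split=> *; first by rewrite mulrDl.
  by rewrite linearD mulrDr.
by rewrite linearZ /= -scalerAl scalerAr.
Qed.

Lemma index_legs : \sw_(x, y <- Δ l) (y * S' x) = S' (epsL H l).
Proof.
rewrite /epsL [RHS]linear_sum; apply: eq_bigr => i _.
by rewrite /= antiVM antiK.
Qed.

Lemma hit_quasi_left a : \sw_(x, y <- Δ l) (hit H lam (a * y) * S' x) = a.
Proof.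
have B : balanced (fun x y => hit H lam y * S' x).
  apply: bal_swap; split=> *; first by rewrite hitD mulrDl.
    by rewrite linearD mulrDr.
  by rewrite hitZ linearZ /= -scalerAl scalerAr.
(* Moving a to the other leg turns S^-1(l_(1)) into S^-1(S(a) l_(1)) = S^-1(l_(1)) a, so a factors
   out on the right and only the case a = 1 is left. *)
rewrite (integral_anti l_int a B); under eq_tsum => x y do rewrite antiVM antiK mulrA.
rewrite -[\sw_(x, y <- _) _]mulr_suml -[RHS]mul1r; congr (_ * a).
transitivity (\sw_(x, y <- Δ l) \sw_(u, v <- Δ y) (⟨ lam | v ⟩ *: (u * S' x))).
  apply: eq_bigr => k _; rewrite hitE /tsum mulr_suml.
  by apply: eq_bigr => i _; rewrite scalerAl.
rewrite -(@coassocE _ _ H _ (fun x y z => ⟨ lam | z ⟩ *: (y * S' x))); first last.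
- move=> x; split=> *; first by rewrite mulrDl scalerDr.
    by rewrite pairDr scalerDl.
  by rewrite pairZr -scalerAl !scalerA mulrC.
- move=> z; have M := mul_antiV_bal.
  by split=> *; rewrite ?(balDl M) ?(balDr M) ?(balZ M) // scalerDr.
rewrite -[RHS]antiV1 -l_lam_dual (hit_integral lam_int) [RHS]linear_sum.
apply: eq_bigr => i _; rewrite /epsL /tsum linearZ /= linear_sum /= scaler_sumr.
by apply: eq_bigr => j _; rewrite /= antiVM antiK.
Qed.

(** Tested against <λ|b _>, the factor b moves next to a as in [hit_quasi_left]. With E = λ ⇀ _,
    which is A_L-valued and A_L-bilinear, <λ|y E(c)> = ε(E(y) E(c)) = <λ|E(y) c>, so the claim
    reduces to [hit_quasi_left] at 1. *)
Lemma hit_quasi_right a : \sw_(x, y <- Δ l) (y * hit H lam (S' x * a)) = a.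
Proof.
apply: (nondegenerate_dual_inj lam_nondeg) => b.
rewrite /tsum mulr_sumr pair_sumr.
transitivity (\sw_(x, y <- Δ l) ⟨ lam | b * y * hit H lam (S' x * a) ⟩).
  by apply: eq_bigr => i _; rewrite mulrA.
have B : balanced (fun x y => ⟨ lam | y * hit H lam (S' x * a) ⟩).
  split=> *; first by rewrite linearD mulrDl hitD mulrDr pairDr.
    by rewrite mulrDl pairDr.
  by rewrite linearZ /= -scalerAl hitZ -scalerAr -scalerAl.
rewrite (integral_anti l_int b B).
under eq_tsum => x y do rewrite antiVM antiK -mulrA -cou_hit
  (hit_leftAr _ _ (hit_integral_leftA lam_int _))
  -(hit_leftA _ _ (hit_integral_leftA lam_int _)) cou_hit mulrA.
rewrite -pair_tsum; congr ⟨ lam | _ ⟩.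
rewrite -[RHS]mul1r -[in RHS](hit_quasi_left 1) [RHS]mulr_suml.
by apply: eq_bigr => i _; rewrite mul1r -!mulrA.
Qed.

Section Expansion.
Variable s : seq (A * A).
Hypothesis cop_l : Δ l = \sum_(p <- s) p.1 ⊗ p.2.

Lemma hit_quasi_basis : quasi_basis (hit H lam) [seq (p.2, S' p.1) | p <- s].
Proof.
move=> a; rewrite !big_map /=; split.
- rewrite -[RHS](hit_quasi_right a); symmetry; apply: (tsum_expand _ cop_l).
  split=> *; first by rewrite linearD mulrDl hitD mulrDr.
    by rewrite mulrDl.
  by rewrite linearZ /= -scalerAl hitZ -scalerAr -scalerAl.
- rewrite -[RHS](hit_quasi_left a); symmetry.
  apply: (tsum_expand (f := fun x y => hit H lam (a * y) * S' x) _ cop_l).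
  split=> *; first by rewrite linearD mulrDr.
    by rewrite mulrDr hitD mulrDl.
  by rewrite -scalerAr hitZ linearZ /= -scalerAr -scalerAl.
Qed.

Lemma Ind_hit : Ind (hit H lam) = S' (epsL H l).
Proof.
rewrite (indexE hit_quasi_basis) big_map -index_legs /=; symmetry.
exact: (tsum_expand mul_antiV_bal cop_l).
Qed.

End Expansion.

(** Applying S^-1 to [antiE] gives b = S^-1(l_(1)) <λ|b l_(2)>; this is inserted in <λ|b a>. *)
Lemma integral_reproduce a :
  \sw_(x, y <- Δ l) (⟨ lam | S' x * a ⟩ *: y) = a.
Proof.
apply: (nondegenerate_dual_inj lam_nondeg) => b.
rewrite /tsum mulr_sumr pair_sumr -[b in RHS]antiK antiE linear_sum.
rewrite mulr_suml pair_sumr; apply: eq_bigr => i _.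
by rewrite -scalerAr linearZ /= -scalerAl !pairZr mulrC.
Qed.

(** Pairing with x leads to p <λ|S^-1(x_(2)) q> with p ⊗ q = Δ(x_(1) l). By [integral_swap] and
    [pair_integral] this is ε(S^-1(x_(2)) x_(1)) x_(3) = ε([epsR] x_(1)) x_(2) = x. *)
Lemma lact_legs_left phi :
  \sw_(p, q <- cop D lam) (lact H l (phi * q) * ((anti D)^-1)%VF p) = phi.
Proof.
apply: dualP => x; rewrite pair_suml.
under eq_bigr => i _ do rewrite dualME.
under eq_bigr => i _ do under eq_tsum => u v do rewrite lactE dualME pair_dual_antiV.
rewrite exchange_big /=.
transitivity (\sw_(u, v <- Δ x) ⟨ phi | \sw_(p, q <- Δ (u * l)) (⟨ lam | S' v * q ⟩ *: p) ⟩).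
  apply: eq_bigr => j _; under eq_bigr => i _ do rewrite /tsum mulr_suml.
  rewrite exchange_big pair_tsum /=; apply: eq_bigr => k _.
  rewrite pairZr -(dual_copE lam) [RHS]mulr_suml; apply: eq_bigr => i _.
  by rewrite [LHS]mulrC mulrA mulrAC.
transitivity (\sw_(u, v <- Δ x) ⟨ phi | \sw_(p, q <- Δ v) (ε (S' p * u) *: q) ⟩).
  apply: eq_tsum => u v; congr ⟨ phi | _ ⟩.
  rewrite (integral_swap lam_int) cop_antiVE; last first.
    split=> *; first by rewrite antiD scalerDr.
      by rewrite mulrDl pairDr scalerDl.
    by rewrite antiZ -scalerAl pairZr !scalerA mulrC.
  by apply: eq_tsum => p q; rewrite antiVK mulrA pair_integral.
rewrite -pair_tsum; congr ⟨ phi | _ ⟩.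
rewrite -(@coassocE _ _ H _ (fun u p q => ε (S' p * u) *: q)); first last.
- move=> u; split=> *; first by rewrite linearD mulrDl couD scalerDl.
    by rewrite scalerDr.
  by rewrite linearZ /= -scalerAl couZ scalerA mulrC.
- move=> z; split=> *; first by rewrite mulrDr couD scalerDl.
    by rewrite linearD mulrDl couD scalerDl.
  by rewrite linearZ /= -scalerAl -scalerAr.
rewrite (antiV_epsR_legs _ (cou_bal H)).
rewrite -[RHS](wh_counitl (wh_axioms H)).
by apply: eq_tsum => u v; rewrite cou_antiV cou_epsR.
Qed.

(** Pairing with x leads to <λ|S^-1(l_(1)) S^-1(x_(2)) x_(1)> x_(3) l_(2). By [epsR_legs] the legs
    of x become S^-1(1_(1)) ⊗ x 1_(2), and Δ(1) is absorbed by Δ(l). Then [integral_anti] moves x to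
    the other leg, where [integral_reproduce] applies. *)
Lemma lact_legs_right phi :
  \sw_(p, q <- cop D lam) (q * lact H l (((anti D)^-1)%VF p * phi)) = phi.
Proof.
apply: dualP => x; rewrite pair_suml.
under eq_bigr => i _ do rewrite dualME.
under eq_bigr => i _ do under eq_tsum => u v do rewrite lactE dualME.
rewrite exchange_big /=.
transitivity (\sw_(u, v <- Δ x) ⟨ phi | \sw_(p, q <- Δ (v * l)) (⟨ lam | S' p * u ⟩ *: q) ⟩).
  apply: eq_bigr => j _; under eq_bigr => i _ do rewrite /tsum mulr_sumr.
  rewrite exchange_big pair_tsum /=; apply: eq_bigr => k _.
  rewrite pairZr -(dual_copE lam) [RHS]mulr_suml; apply: eq_bigr => i _.
  by rewrite pair_dual_antiV mulrA [X in X * _]mulrC.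
rewrite -pair_tsum; congr ⟨ phi | _ ⟩.
pose G (u v w : A) : A := \sw_(p, q <- Δ l) (⟨ lam | S' p * (S' v * u) ⟩ *: (w * q)).
transitivity (\sw_(u, v <- Δ x) \sw_(p, q <- Δ v) G u p q).
  apply: eq_tsum => u v; rewrite copME; last first.
    split=> *; first by rewrite linearD mulrDl pairDr scalerDl.
      by rewrite scalerDr.
    by rewrite linearZ /= -scalerAl pairZr scalerA mulrC.
  apply: eq_tsum => p q; apply: eq_tsum => y z.
  by rewrite antiVM -mulrA.
have FB : balanced (fun a w => \sw_(p, q <- Δ l) (⟨ lam | S' p * a ⟩ *: (w * q))).
  apply: bal_tsum => p q; split=> *; first by rewrite mulrDr pairDr scalerDl.
    by rewrite mulrDl scalerDr.
  by rewrite -scalerAr pairZr -scalerAl scalerA mulrC.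
rewrite -(@coassocE _ _ H _ G); first last.
- move=> u; apply: bal_tsum => p q; split=> *.
  + by rewrite linearD mulrDl mulrDr pairDr scalerDl.
  + by rewrite mulrDl scalerDr.
  + by rewrite linearZ /= -scalerAl -scalerAr pairZr -scalerAl scalerA mulrC.
- move=> z; apply: bal_tsum => p q; split=> *.
  + by rewrite !mulrDr pairDr scalerDl.
  + by rewrite linearD mulrDl mulrDr pairDr scalerDl.
  + by rewrite linearZ /= -scalerAl -!scalerAr.
rewrite /G (antiV_epsR_legs _ FB).
have FB' := bal_compl FB linear_antiV.
rewrite (epsR_legs H _ FB').
have lB := pair_ball lam.
transitivity (\sw_(p, q <- Δ l) (⟨ lam | S' p ⟩ *: (x * q))).
  have B : balanced (fun p q => ⟨ lam | S' p ⟩ *: (x * q)).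
    exact: (bal_rmull _ (bal_compl lB linear_antiV)).
  rewrite -[in RHS](mul1r l) copME //.
  apply: eq_tsum => u v; apply: eq_tsum => p q.
  by rewrite antiVM mulrA.
rewrite (integral_anti l_int _ (bal_compl lB linear_antiV)).
rewrite -[RHS]integral_reproduce; apply: eq_tsum => p q.
by rewrite antiVM antiK.
Qed.

Lemma Ind_lact : Ind (lact H l) = nR D lam.
Proof.
pose t := cop D lam.
(* In the encoding of the coproduct of λ the basis vectors are the second legs, so the pairs are
   λ_(2), S^-1(λ_(1)) and their products sum to n_R(λ) by definition. *)
pose s := [seq (vb i, ((anti D)^-1)%VF (t i)) | i <- index_enum 'I_(dim (dual H))].
rewrite (@indexE _ _ s); first by rewrite big_map.
move=> phi; rewrite !big_map; split; [exact: lact_legs_right|exact: lact_legs_left].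
Qed.

(** After flipping Δ(1) by S ⊗ S, the first leg is S(b) with b in A_L. Then Δ(b) = 1_(1) b ⊗ 1_(2)
    and S(1_(1)) 1_(2) = 1 yield [epsL](S(b)) = S(S(b)). *)
Lemma epsL_legs1 W (f : A -> A -> W) : balanced f ->
  \sw_(x, y <- Δ 1) f (epsL H x) y = \sw_(x, y <- Δ 1) f (S x) y.
Proof.
move=> fB; have fLB := bal_compl fB (linear_epsL H).
have fSB := bal_compl fB (linear_anti H).
rewrite cop1_anti // [RHS]cop1_anti //; apply: eq_tsum1 => [||x b bL].
- apply: (@bal_comp _ A A A A _ (fun x y => f (epsL H y) x)); try exact: linear_anti.
  exact: bal_swap.
- apply: (@bal_comp _ A A A A _ (fun x y => f (S y) x)); try exact: linear_anti.
  exact: bal_swap.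
congr f; rewrite /epsL cop_antiE; last first.
  split=> *; first by rewrite mulrDl.
    by rewrite antiD mulrDr.
  by rewrite antiZ -scalerAl scalerAr.
rewrite (cop_leftArE bL); last first.
  split=> *; first by rewrite !antiD mulrDr.
    by rewrite antiD mulrDl.
  by rewrite !antiZ -scalerAl -scalerAr.
have e1 : \sw_(x, y <- Δ 1) (S x * y) = 1.
  rewrite -[LHS]/(epsR H 1) epsRE -[RHS](wh_counitr (wh_axioms H)).
  by apply: eq_tsum => u v; rewrite mul1r.
rewrite -[RHS]mul1r -[X in _ = X * _]anti1 -[X in _ = S X * _]e1 anti_tsum /tsum mulr_suml.
by apply: eq_bigr => i _; rewrite !antiM mulrA.
Qed.

End DualPair.

(** * Centrality of the Watatani index *)

Section WatataniIndex.
Variables (B : nzRingType) (E : B -> B) (s : seq (B * B)).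
Hypothesis sE : quasi_basis E s.

(** Expanding v_i c by one half of the quasi-basis and c u_j by the other turns both products into
    the same double sum of u_i E(v_i c u_j) v_j. *)
Lemma Ind_center : center B (Ind E).
Proof.
move=> c; rewrite (indexE sE) mulr_suml mulr_sumr.
under eq_bigr => p _ do rewrite -mulrA -[p.2 * c](sE _).2 mulr_sumr.
under [RHS]eq_bigr => p _ do rewrite mulrA -[c * p.1](sE _).1 mulr_suml.
rewrite exchange_big; apply: eq_bigr => p _; apply: eq_bigr => q _.
by rewrite !mulrA.
Qed.

End WatataniIndex.

(** * Elements φ ⇀ 1 of A_R and their centrality in A *)

Section Right.
Context {C : numClosedFieldType} {A : falgType C}.
Variable H : weakCHopf A.
Local Notation Δ := (cop H).
Local Notation ε := (cou H : A -> C).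
Implicit Types (a b x y : A) (phi psi : dual H) (W : zmodType).

(** The counterpart for A_R of [cop_leftA_tens]: in the factorized form of (Δ ⊗ id)Δ(1), φ only
    meets the third leg. *)
Lemma cop_hit1 W (f : A -> A -> W) phi : balanced f ->
  \sw_(x, y <- Δ (hit H phi 1)) f x y =
  \sw_(x, y <- Δ 1) f x (y * hit H phi 1).
Proof.
move=> fB; pose G (x y z : A) := f x (⟨ phi | z ⟩ *: y).
have G12 z : balanced (fun x y => G x y z).
  split=> *; rewrite /G ?scalerDr ?(balDl fB) ?(balDr fB) //.
  by rewrite (balZ fB) !scalerA mulrC.
have G23 x : balanced (G x).
  split=> *; rewrite /G ?scalerDr ?pairDr ?scalerDl ?(balDr fB) //.
  by rewrite pairZr scalerA mulrC.
transitivity (\sw_(x, y <- Δ 1) \sw_(u, v <- Δ x) G u v y).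
  rewrite hitE [in LHS]linear_sum tsum_sum; last exact: balDl fB.
  apply: eq_bigr => i _; rewrite linearZ /=; apply: eq_bigr => j _.
  by rewrite ffunE (balZ fB).
have fB3 := bal3 G12 G23.
have := congr1 (fun t => tsum t (fun t z => tsum t (fun x y => G x y z)))
  (wh_cop1 (wh_axioms H)).
rewrite tsum_tsum; last exact: balDl fB3.
rewrite tsum_tsum; last exact: balDl fB3.
under [X in _ = X -> _]eq_tsum => x y do rewrite (tsum_tens _ _ fB3).
move=> <-; apply: eq_tsum => x y.
rewrite tsum_tsum; last exact: balDl fB3.
under eq_tsum => u v do rewrite (tsum_tens _ _ fB3) (tsum_tens _ _ (G12 _)).
rewrite hitE /tsum mulr_sumr (bal_sumr _ _ _ _ fB).
by apply: eq_bigr => i _; rewrite /G scalerAr.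
Qed.

Lemma cop_mul_hit1 W (f : A -> A -> W) phi a : balanced f ->
  \sw_(x, y <- Δ (a * hit H phi 1)) f x y =
  \sw_(x, y <- Δ a) f x (y * hit H phi 1).
Proof.
move=> fB; rewrite copME // -[in RHS](mulr1 a) copME; last exact: bal_rmulr.
apply: eq_tsum => x y; rewrite cop_hit1; last first.
  exact: (bal_lmull _ (bal_rmull _ fB)).
by apply: eq_tsum => u v; rewrite mulrA.
Qed.

(** With r = φ ⇀ 1, the left side is a_(1) ε(a_(2) r), and a_(1) ⊗ a_(2) r = Δ(a r). *)
Lemma hit_lact_hit1 phi a :
  hit H (lact H (hit H phi 1) 1) a = a * hit H phi 1.
Proof.
rewrite -[RHS](wh_counitr (wh_axioms H)) (cop_mul_hit1 (f := fun x y => ε y *: x)).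
  by rewrite hitE; apply: eq_tsum => x y; rewrite lactE dual1E.
exact: (pair_balr (cou H : dual H)).
Qed.

Lemma hit_mul phi psi a : hit H (phi * psi) a = hit H phi (hit H psi a).
Proof.
apply: (@dual_sep _ _ H) => chi.
have hp phi' b chi' : ⟨ chi' | hit H phi' b ⟩ = ⟨ chi' * phi' | b ⟩.
  rewrite hitE pair_tsum dualME; apply: eq_tsum => x y.
  by rewrite pairZr mulrC.
by rewrite !hp mulrA.
Qed.

Lemma hit_one a : hit H (1 : dual H) a = a.
Proof. exact: (wh_counitr (wh_axioms H)). Qed.

Lemma hit_central phi a : center (dual H) phi ->
  \sw_(x, y <- Δ a) (⟨ phi | x ⟩ *: y) = hit H phi a.
Proof.
move=> phiC; apply: (@dual_sep _ _ H) => psi.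
rewrite hitE !pair_tsum.
under eq_tsum => x y do rewrite pairZr.
under [RHS]eq_tsum => x y do rewrite pairZr mulrC.
by rewrite -!dualME phiC.
Qed.

(** Weak multiplicativity splits ε(w a_(1)) as ε(w 1_(1)) ε(1_(2) a_(1)); as 1_(2) runs through A_L,
    the second factor rebuilds 1_(2) a. *)
Lemma ract1_legs w a :
  \sw_(x, y <- Δ a) (⟨ ract (1 : dual H) w | x ⟩ *: y) =
  (\sw_(u, v <- Δ 1) (ε (w * u) *: v)) * a.
Proof.
rewrite /tsum mulr_suml.
transitivity (\sw_(u, v <- Δ 1) \sw_(x, y <- Δ a) ((ε (w * u) * ε (v * x)) *: y)).
  rewrite exchange_tsum; apply: eq_bigr => i _.
  rewrite ractE dual1E -[w]mulr1 (wh_couM (wh_axioms H)) /tsum scaler_suml.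
  by rewrite mulr1.
have B : balanced (fun u v => ε (w * u) *: (v * a)).
  exact: (bal_lmull _ (bal_rmulr _ (cou_bal H))).
transitivity (\sw_(u, v <- Δ 1) (ε (w * u) *: (v * a))); last first.
  by apply: eq_bigr => i _; rewrite scalerAl.
apply: eq_tsum1 => // [|u b bL].
  apply: bal_tsum => x y; split=> *.
  - by rewrite mulrDr couD mulrDl scalerDl.
  - by rewrite mulrDl couD mulrDr scalerDl.
  - by rewrite -scalerAr -scalerAl !couZ mulrCA mulrA.
rewrite -(couD_leftAl a bL) /tsum scaler_sumr.
by apply: eq_bigr => i _; rewrite scalerA.
Qed.

(** The element of the dual acts on A as right multiplication by φ ⇀ 1 and, being central and of the
    form 1 ↼ w, also as left multiplication by some c. Evaluation at 1 identifies c with φ ⇀ 1. *)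
Lemma hit1_central phi w :
  center (dual H) (lact H (hit H phi 1) 1) ->
  lact H (hit H phi 1) 1 = ract 1 w ->
  center A (hit H phi 1).
Proof.
move=> nC e; have key a := ract1_legs w a.
have {}key a : a * hit H phi 1 = (\sw_(u, v <- Δ 1) (ε (w * u) *: v)) * a.
  by rewrite -key -e hit_central // hit_lact_hit1.
by move=> a; rewrite key -[hit H phi 1]mul1r key mulr1.
Qed.

End Right.

(** * Products in M ⋊ A and the action of the dual on it *)

Section CrossedProduct.
Context {C : numClosedFieldType} {A : falgType C}.
Variables (H : weakCHopf A) (M : algType C) (K : module_algebra H M).
Local Notation Δ := (cop H).
Local Notation ε := (cou H : A -> C).
Local Notation "m ⋊ a" := (cp K m a).
Local Notation "a ▷ m" := (act K a m).
Implicit Types (a b : A) (m n : M) (phi : dual H).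

Lemma cp_sumr m I r (P : pred I) (a : I -> A) :
  m ⋊ (\sum_(i <- r | P i) a i) = \sum_(i <- r | P i) (m ⋊ a i).
Proof. exact: bal_sumr (cp_bal K). Qed.

Lemma cp_suml a I r (P : pred I) (m : I -> M) :
  (\sum_(i <- r | P i) m i) ⋊ a = \sum_(i <- r | P i) (m i ⋊ a).
Proof. exact: bal_suml (cp_bal K). Qed.

Lemma act_suml m I r (P : pred I) (a : I -> A) :
  (\sum_(i <- r | P i) a i) ▷ m = \sum_(i <- r | P i) (a i ▷ m).
Proof.
by apply: (big_morph (fun a => a ▷ m)) => [x y|]; [exact: actDl|exact: act0l].
Qed.

Lemma cp_mulr m a b : (m ⋊ a) * (1 ⋊ b) = m ⋊ (a * b).
Proof. by rewrite cpM cp_epsL. Qed.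

Lemma cp_mull m n a : (m ⋊ 1) * (n ⋊ a) = (m * n) ⋊ a.
Proof.
rewrite cpM.
have B : balanced (fun x y => (m * ((x ▷ n) * (y ▷ 1))) ⋊ a).
  split=> *; rewrite ?actDl ?mulrDl ?mulrDr ?(balDl (cp_bal K)) //.
  by rewrite !actZl -scalerAl -!scalerAr.
(* The second legs of Δ(1) lie in A_L, so they cross over to M; the two legs then recombine into 1 ▷
   n. *)
transitivity (\sw_(x, y <- Δ 1) ((m * ((x ▷ n) * (y ▷ 1))) ⋊ a)).
  apply: eq_tsum1 => // [|x b bL]; first exact: mul_bal4.
  by rewrite cp_leftA // mulrA.
by rewrite -[n in RHS](act1 K) -[n in RHS]mulr1 actM /tsum mulr_sumr cp_suml.
Qed.

Lemma dactD phi : {morph dact phi : x y / x + y :> crossed K}.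
Proof.
have B : balanced (fun m a => m ⋊ hit H phi a).
  exact: (bal_compr (cp_bal K) (linear_hit phi)).
(* [dact] is defined on a chosen representative, so additivity first requires its value on an
   arbitrary one. *)
have dactE t : dact phi (cpi K t) = \sw_(m, a <- t) (m ⋊ hit H phi a).
  rewrite cpi_tsum.
  apply: (@cross_factor _ _ _ _ K _ (fun t => tsum t _)) => [s u|n b c bL|].
  - by apply: tsumD; exact: balDl B.
  - by rewrite !(tsum_tens _ _ B) (hit_leftA _ _ bL) cp_leftA.
  - by rewrite cpi_repr cpi_tsum.
move=> x y; rewrite -(cpi_repr x) -(cpi_repr y) -cpiD !dactE tsumD //.
exact: balDl B.
Qed.

Lemma dact0 phi : dact phi (0 : crossed K) = 0.
Proof. by apply: (addIr (dact phi 0)); rewrite -dactD !add0r. Qed.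

Lemma dact_sum phi I r (P : pred I) (x : I -> crossed K) :
  dact phi (\sum_(i <- r | P i) x i) = \sum_(i <- r | P i) dact phi (x i).
Proof. exact: (big_morph _ (dactD phi) (dact0 phi)). Qed.

Lemma dact_mul_sumr phi (x : crossed K) I r (P : pred I) (y : I -> crossed K) :
  dact phi (x * \sum_(i <- r | P i) y i) =
  \sum_(i <- r | P i) dact phi (x * y i).
Proof. by rewrite mulr_sumr dact_sum. Qed.

(** In (m ⋊ a)(n ⋊ 1) the first leg of a acts on n while φ meets only the last leg; coassociativity
    separates the two. *)
Lemma dact_mulr phi (x : crossed K) n :
  dact phi (x * (n ⋊ 1)) = dact phi x * (n ⋊ 1).
Proof.
elim/(@cross_ind _ _ H M K): x => [m a|x y IHx IHy]; last first.
  by rewrite mulrDl !dactD IHx IHy mulrDl.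
rewrite dact_cp !cpM dact_sum.
have B := mul_bal4 K m n 1.
pose G x y z := ⟨ phi | z ⟩ *: ((m * (x ▷ n)) ⋊ (y * 1)).
transitivity (\sw_(x, y <- Δ a) \sw_(u, v <- Δ y) G x u v).
  apply: eq_bigr => i _; rewrite dact_cp mulr1 hitE cp_sumr.
  by apply: eq_bigr => j _; rewrite -(balZ (cp_bal K)) cpZl /G mulr1.
rewrite -coassocE; first last.
- move=> x; split=> *; rewrite /G ?(balDr B) ?scalerDr ?pairDr ?scalerDl //.
  by rewrite pairZr -(balZ B) actZl -scalerAr cpZl !scalerA mulrC.
- move=> z; split=> *; rewrite /G ?(balDl B) ?(balDr B) ?(balZ B) ?scalerDr //.
rewrite hitE [in RHS]linear_sum tsum_sum; last exact: balDl B.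
apply: eq_bigr => i _; rewrite linearZ /=; apply: eq_bigr => j _.
by rewrite ffunE actZl -scalerAr cpZl.
Qed.

End CrossedProduct.

(** * The quasi-basis passes from A to M ⋊ A *)

Section CrossedBasis.
Context {C : numClosedFieldType} {A : falgType C}.
Variables (H : weakCHopf A) (l : A) (lam : dual H).
Hypothesis l_int : left_integral H l.
Hypothesis lam_int : left_integral (dual_data H) lam.
Hypothesis l_nondeg : nondegenerate_for H l.
Hypothesis lam_nondeg : nondegenerate_dual lam.
Hypothesis l_lam_dual : dual_integrals l lam.
Variables (M : algType C) (K : module_algebra H M).
Local Notation Δ := (cop H).
Local Notation ε := (cou H : A -> C).
Local Notation S' := ((anti H)^-1)%VF.
Local Notation "m ⋊ a" := (cp K m a).
Local Notation "a ▷ m" := (act K a m).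
Implicit Types (a b : A) (m n : M) (phi : dual H).

Let antiVM := antiVM l_int l_nondeg l_lam_dual.
Let antiK := antiK l_int l_nondeg.

(** The right side is (a_(2) S^-1(a_(1)) ▷ m) ⋊ a_(3) = (S^-1([epsL] a_(1)) ▷ m) ⋊ a_(2). By
    [epsL_legs] and [epsL_legs1] it equals (1_(1) ▷ m) ⋊ 1_(2) a, which is (1 ⋊ 1)(m ⋊ a). *)
Lemma cp_span m a :
  m ⋊ a = \sw_(x, y <- Δ a) ((1 ⋊ y) * ((S' x ▷ m) ⋊ 1)).
Proof.
pose G x y z := ((y * S' x) ▷ m) ⋊ z.
transitivity (\sw_(x, y <- Δ a) \sw_(u, v <- Δ y) G x u v); last first.
  apply: eq_tsum => x y; rewrite cpM; apply: eq_tsum => u v.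
  by rewrite mul1r mulr1 /G actA.
rewrite -coassocE; first last.
- move=> x; split=> *; rewrite /G ?mulrDl ?actDl ?(balDl (cp_bal K)) ?(balDr (cp_bal K)) //.
  by rewrite -scalerAl actZl (balZ (cp_bal K)).
- move=> z; split=> *; rewrite /G ?linearD ?mulrDl ?mulrDr ?actDl ?(balDl (cp_bal K)) //.
  by rewrite linearZ /= -scalerAl -scalerAr.
have B : balanced (fun x y => (S' x ▷ m) ⋊ y).
  split=> *; rewrite ?linearD ?actDl ?(balDl (cp_bal K)) ?(balDr (cp_bal K)) //.
  by rewrite linearZ /= actZl (balZ (cp_bal K)).
transitivity (\sw_(x, y <- Δ a) ((S' (epsL H x) ▷ m) ⋊ y)); last first.
  apply: eq_tsum => x y; rewrite /epsL /tsum linear_sum act_suml cp_suml.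
  by apply: eq_bigr => i _; rewrite /= antiVM antiK.
rewrite -[X in \sw_(_, _ <- Δ X) _]mul1r (epsL_legs _ _ _ B).
rewrite (epsL_legs1 l_int lam_int l_lam_dual (bal_rmulr _ B)).
under eq_tsum => x y do rewrite antiK.
by rewrite -[LHS]mul1r -(cp1 K) cpM; apply: eq_tsum => x y; rewrite mul1r.
Qed.

Section Expansion.
Variable s : seq (A * A).
Hypothesis cop_l : Δ l = \sum_(p <- s) p.1 ⊗ p.2.

Lemma cross_quasi_basis :
  quasi_basis (Ehat (K := K) lam) [seq (1 ⋊ p.2, 1 ⋊ S' p.1) | p <- s].
Proof.
have qb := hit_quasi_basis l_int lam_int l_nondeg lam_nondeg l_lam_dual cop_l.
move=> b; rewrite !big_map /=; split; last first.
  elim/(@cross_ind _ _ H M K): b => [m a|x y IHx IHy]; last first.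
    rewrite -[in RHS]IHx -[in RHS]IHy -big_split; apply: eq_bigr => p _ /=.
    by rewrite mulrDl /Ehat dactD mulrDl.
  under eq_bigr => p _ do rewrite cp_mulr EhatE cp_mulr.
  by rewrite -cp_sumr; have := (qb a).2; rewrite big_map /= => ->.
elim/(@cross_ind _ _ H M K): b => [m a|x y IHx IHy]; last first.
  rewrite -[in RHS]IHx -[in RHS]IHy -big_split; apply: eq_bigr => p _ /=.
  by rewrite mulrDr /Ehat dactD mulrDr.
(* On products (1 ⋊ a)(k ⋊ 1), the factor k ⋊ 1 comes out by right M-linearity, leaving the
   quasi-basis identity in A. *)
rewrite cp_span /tsum; under eq_bigr => p _ do rewrite /Ehat dact_mul_sumr mulr_sumr.
rewrite exchange_big; apply: eq_bigr => i _ /=.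
under eq_bigr => p _ do rewrite mulrA cp_mulr dact_mulr dact_cp mulrA cp_mulr.
rewrite -mulr_suml -cp_sumr.
by have := (qb (vb i)).1; rewrite big_map /= => ->.
Qed.

Lemma Ind_Ehat : Ind (Ehat (K := K) lam) = 1 ⋊ Ind (hit H lam).
Proof.
have qb := hit_quasi_basis l_int lam_int l_nondeg lam_nondeg l_lam_dual cop_l.
rewrite (indexE cross_quasi_basis) (indexE qb) !big_map cp_sumr /=.
by apply: eq_bigr => p _; rewrite cp_mulr.
Qed.

End Expansion.

End CrossedBasis.

(** * Values and indices, and the normalized case *)

Section Consequences.
Context {C : numClosedFieldType} {A : falgType C}.
Variables (H : weakCHopf A) (l : A) (lam : dual H).
Hypothesis l_int : left_integral H l.
Hypothesis lam_int : left_integral (dual_data H) lam.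
Hypothesis l_nondeg : nondegenerate_for H l.
Hypothesis lam_nondeg : nondegenerate_dual lam.
Hypothesis l_lam_dual : dual_integrals l lam.
Variables (M : algType C) (K : module_algebra H M).
Local Notation Δ := (cop H).
Local Notation ε := (cou H : A -> C).
Local Notation S' := ((anti H)^-1)%VF.
Local Notation "m ⋊ a" := (cp K m a).
Local Notation "a ▷ m" := (act K a m).
Local Notation z := (hit H lam 1).
Local Notation n := (nR (dual_data H) lam).
Implicit Types (a b : A) (m : M) (phi : dual H).

Lemma cop_expansion a :
  Δ a = \sum_(p <- [seq ((Δ a) i, vb i) | i <- index_enum 'I_(dim A)]) p.1 ⊗ p.2.
Proof. by rewrite big_map -[LHS]tsumE. Qed.

Lemma tau_nR : tau K n = z ▷ 1.
Proof. by rewrite (dual_nR l_int lam_int l_nondeg l_lam_dual) tauE. Qed.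

Lemma leftA_hit1 : leftA H z.
Proof. exact: hit_integral_leftA. Qed.

(** λ ⇀ 1 lies in A_L and in A_R: the former gives z ▷ m = (z ▷ 1) m, the latter z ▷ m = m (z ▷
    1). *)
Lemma act_hit1_center : center M (z ▷ 1).
Proof.
move=> m; rewrite -act_leftA; last exact: leftA_hit1.
have B : balanced (fun x y => (x ▷ m) * (y ▷ 1)).
  split=> *; rewrite ?actDl ?mulrDl ?mulrDr //.
  by rewrite !actZl -scalerAl -scalerAr.
rewrite -[in LHS](mulr1 m) actM cop_hit1 //.
by under eq_tsum => x y do rewrite actA; rewrite -actM act1.
Qed.

Lemma Ind_hit_right : exists phi, Ind (hit H lam) = hit H phi 1.
Proof.
(* The index is ε(1_(1) l) S^-1(1_(2)); flipping Δ(1) by S ⊗ S turns it into ε(S(1_(2)) l) 1_(1). *)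
exists (dual_of H (fun y => ε (anti H y * l))).
rewrite (Ind_hit l_int lam_int l_nondeg lam_nondeg l_lam_dual (cop_expansion l)).
rewrite epsLE linear_sum hitE.
have B : balanced (fun x y => ε (x * l) *: S' y).
  exact: (bal_compr (bal_lmulr _ (cou_bal H)) (linear_antiV _)).
transitivity (\sw_(x, y <- Δ 1) (ε (x * l) *: S' y)).
  by apply: eq_bigr => i _; rewrite linearZ.
rewrite (cop1_anti l_int lam_int l_lam_dual B); apply: eq_tsum => x y.
rewrite (antiK l_int l_nondeg) dual_ofE // => c u v.
by rewrite antiD antiZ mulrDl couD -scalerAl couZ.
Qed.

Lemma Ehat_cp m a : Ehat lam (m ⋊ a) = (m * (hit H lam a ▷ 1)) ⋊ 1.
Proof.
rewrite EhatE -[in LHS](mulr1 (hit H lam a)) cp_leftA //.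
exact: hit_integral_leftA.
Qed.

Section Normalized.
Hypothesis l_norm : normalized H l.
Hypothesis n_unit : n \is a GRing.unit.
Hypothesis n_left : dualL H n.
Hypothesis n_center : center (dual H) n.
Local Notation lam' := (n^-1 * lam).

Let nE := dual_nR l_int lam_int l_nondeg l_lam_dual.

Lemma hit1_center : center A z.
Proof.
case: n_left => w nw; apply: (@hit1_central _ _ _ _ w).
  by rewrite -nE.
by rewrite -nE.
Qed.

Lemma hit_nR a : hit H n a = a * z.
Proof. by rewrite nE hit_lact_hit1. Qed.

Lemma hit_lamdot a : hit H lam a = hit H lam' a * z.
Proof. by rewrite -hit_nR -hit_mul mulrA divrr // mul1r. Qed.

(** Normalization says ε(x l) = ε(x), so the counit formula at l agrees with the one at 1. *)
Lemma epsL_normalized : epsL H l = 1.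
Proof.
rewrite epsLE -[RHS](wh_counitl (wh_axioms H)); apply: eq_tsum => x y.
congr (_ *: _); have := congr1 (fun p => ⟨ p | x ⟩) l_norm.
by rewrite lactE !dual1E.
Qed.

Lemma Ind_lamdot : Ind (hit H lam') = z.
Proof.
(* As n_R(λ) acts by multiplication by z, its inverse applied to 1 gives the inverse of z. *)
have zC := hit1_center; pose zi := hit H (n^-1%R : dual H) 1.
have ziz : zi * z = 1 by rewrite -hit_nR -hit_mul divrr // hit_one.
have hit' a : hit H lam' a = hit H lam a * zi.
  by rewrite hit_lamdot -mulrA zC ziz mulr1.
have sl := cop_expansion l; set s := [seq _ | _ <- _] in sl.
have qb := hit_quasi_basis l_int lam_int l_nondeg lam_nondeg l_lam_dual sl.
(* The factor z in the first entries cancels the inverse of z that distinguishes the two maps. The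
   index is therefore multiplied by z. *)
have qb' : quasi_basis (hit H lam') [seq (p.1 * z, p.2) | p <- [seq (p.2, S' p.1) | p <- s]].
  move=> a; rewrite big_map [X in _ /\ X = _]big_map; split.
    rewrite -[RHS](qb a).1; apply: eq_bigr => p _ /=.
    by rewrite hit' -mulrA [z * _]zC -!mulrA ziz mulr1.
  rewrite -[RHS](qb a).2; apply: eq_bigr => p _ /=.
  rewrite hit' mulrA (hit_leftAr _ _ leftA_hit1).
  by rewrite -[hit _ _ _ * z * zi]mulrA zC ziz mulr1.
rewrite (indexE qb') big_map.
under eq_bigr => p _ do rewrite /= -mulrA zC mulrA.
rewrite -mulr_suml -(indexE qb).
rewrite (Ind_hit l_int lam_int l_nondeg lam_nondeg l_lam_dual sl) epsL_normalized.
by rewrite (antiV1 l_int l_nondeg l_lam_dual) mul1r.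
Qed.

Lemma Ehat_lamdot (x : crossed K) : Ehat lam x = (tau K n ⋊ 1) * Ehat lam' x.
Proof.
elim/(@cross_ind _ _ H M K): x => [m a|x y IHx IHy]; last first.
  by rewrite /Ehat !dactD mulrDr -!/(Ehat _ _) IHx IHy.
rewrite !EhatE cp_mull tau_nR hit_lamdot -hit1_center cp_leftA.
  by rewrite act_hit1_center.
exact: leftA_hit1.
Qed.

Lemma cp_tau_nR : tau K n ⋊ 1 = 1 ⋊ z.
Proof.
by rewrite tau_nR -[z in RHS]mulr1 cp_leftA ?mul1r //; exact: leftA_hit1.
Qed.

Lemma invariant_tau : invariants K (tau K n).
Proof.
move=> a; rewrite tau_nR -!actA -!hit1_center !actA.
by rewrite act_one.
Qed.

(** Multiplication on the left gives (z ▷ 1) m ⋊ a; on the right, as 1 ⋊ z, it gives m ⋊ a z = m ⋊ z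
    a = m (z ▷ 1) ⋊ a. *)
Lemma center_tau : center (crossed K) (tau K n ⋊ 1).
Proof.
move=> x; elim/(@cross_ind _ _ H M K): x => [m a|x y IHx IHy]; last first.
  by rewrite mulrDr mulrDl IHx IHy.
rewrite [in RHS]cp_tau_nR cp_mulr cp_mull -hit1_center tau_nR cp_leftA.
  by rewrite act_hit1_center.
exact: leftA_hit1.
Qed.

End Normalized.

End Consequences.

Theorem theorem3p2p3 (R : realType) (A : falgType R[i]) (H : weakCHopf A)
    (l : A) (lam : dual H)
    (l_integral : left_integral H l)
    (lam_integral : left_integral (dual_data H) lam)
    (l_nondegenerate : nondegenerate_for H l)
    (lam_nondegenerate : nondegenerate_dual lam)
    (l_lam_dual : dual_integrals l lam)
    (M : algType R[i]) (K : module_algebra H M) :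
  let E : crossed K -> crossed K := Ehat lam in
  let nRlam : dual H := nR (dual_data H) lam in
  let Indl : dual H := Ind (lact H l) in
  let Indlam : A := Ind (hit H lam) in
  let S' := ((anti H)^-1)%VF in
  (* E takes its values in M = M ⋊ 1 *)
  (forall m a, E (cp K m a) = cp K (m * act K (hit H lam a) 1) 1) /\
  (* quasi-basis, for every expansion of the comultiplication of l *)
  (forall s : seq (A * A), cop H l = \sum_(p <- s) p.1 ⊗ p.2 ->
     quasi_basis E [seq (cp K 1 p.2, cp K 1 (S' p.1)) | p <- s]) /\
  index_finite E /\
  E (cp K 1 l) = cp K 1 1 /\
  (dualR H nRlam /\ dualR H Indl /\
   E (cp K 1 1) = cp K (tau K nRlam) 1 /\
   tau K nRlam = tau K Indl /\
   (center M `&` moduleR K) (tau K Indl)) /\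
  (Ind E = cp K 1 Indlam /\
   (crossedR K `&` center (crossed K)) (cp K 1 Indlam)) /\
  (normalized H l -> Indl \is a GRing.unit ->
   (dualL H `&` dualR H `&` center (dual H)) Indl ->
   let lamdot : dual H := nRlam^-1 * lam in
   (forall x : crossed K, E x = cp K (tau K Indl) 1 * Ehat lamdot x) /\
   cp K (tau K Indl) 1 = cp K 1 (Ind (hit H lamdot)) /\
   invariants K (tau K Indl) /\
   center (crossed K) (cp K (tau K Indl) 1)).
Proof.
move=> E nRlam Indl Indlam S'.
(* All claims about the index of l are proved below for n_R(λ). *)
have Indl_nR : Indl = nRlam by exact: Ind_lact.
have sl := cop_expansion H l.
have qb := cross_quasi_basis l_integral lam_integral l_nondegenerate lam_nondegenerate
  l_lam_dual (K := K) sl.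
have nR_right : dualR H nRlam.
  by exists (hit H lam 1); exact: dual_nR.
have E1 : Ind E = cp K 1 Indlam.
  exact: (Ind_Ehat l_integral lam_integral _ _ _ _ sl).
split; first exact: Ehat_cp.
split; first by move=> s sE; exact: cross_quasi_basis.
split; first by eexists; exact: qb.
split; first by rewrite /E EhatE l_lam_dual.
split.
  rewrite Indl_nR; split=> //; split=> //; split.
    rewrite /E Ehat_cp // mul1r -(@tau_nR _ _ H l lam) //.
  split=> //; rewrite (@tau_nR _ _ H l lam) //; split.
    exact: act_hit1_center.
  by exists (hit H lam 1).
split.
  split=> //; split; last by rewrite -E1; apply: Ind_center; exact: qb.
  have [|||||phi e] := @Ind_hit_right _ _ H l lam => //.
  by exists phi; rewrite -cp1 dact_cp /Indlam e.
rewrite Indl_nR => l_norm n_unit [[n_left _] n_center] lamdot.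
split; first exact: (@Ehat_lamdot _ _ H l lam).
split; last split.
- by rewrite (@Ind_lamdot _ _ H l lam) // (@cp_tau_nR _ _ H l lam).
- exact: (@invariant_tau _ _ H l lam).
- exact: (@center_tau _ _ H l lam).
Qed.
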